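(* Let $r\ge1$ be an integer, let $L(r)=\frac{(r+1)^{r+1}}{r^r}$, and let $F_{\langle r\rangle}$ be the probability distribution on $\mathbb{R}$ with moments $\int_{\mathbb{R}}x^k\,dF_{\langle r\rangle}(x)=\frac{1}{k+1}\binom{(r+1)k}{k}$, $k=0,1,2,\dots$. Then the measure $F_{\langle r\rangle}$ has a density $F'_{\langle r\rangle}$ with support $$\mathrm{supp}\,F'_{\langle r\rangle}:=\overline{\{x: F'_{\langle r\rangle}(x)>0\}}=[0,L(r)].$$ Moreover, at the edges of the support the density behaves as $$F'_{\langle r\rangle}(x)\sim\begin{cases} c\,x^{-\frac{r}{r+1}}, & \text{as } x\searrow 0,\\[1ex] c'\,\sqrt{L(r)-x}, & \text{as } x\nearrow L(r),\end{cases}$$ for some constants $c,c'>0$.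
   Context: $F_{\langle r\rangle}$ is uniquely determined by its moments. Density means density with respect to Lebesgue measure on $\mathbb{R}$. $f(x)\sim g(x)$ means $f(x)/g(x)\to1$ in the indicated limit. *)

(* Defs.v *)
From HB Require Import structures.
From mathcomp Require Import all_boot all_order all_algebra.
From mathcomp Require Import all_classical all_reals all_analysis.

Set Implicit Arguments.
Unset Strict Implicit.
Unset Printing Implicit Defensive.

Import Order.TTheory GRing.Theory Num.Theory.
Import numFieldNormedType.Exports.

Local Open Scope classical_set_scope.
Local Open Scope ring_scope.

Definition L (R : realType) (r : nat) : R := r.+1%:R ^+ r.+1 / r%:R ^+ r.

(* No separate integrability clause is needed: [x ^+ k] is measurable, and with
   the convention [+oo - oo = -oo] its integral is a real number only if both
   its positive and its negative part have a finite integral. *)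
Definition has_moments (R : realType) (F : probability (measurableTypeR R) R)
    (m : nat -> R) : Prop :=
  forall k : nat, (\int[F]_x (x ^+ k)%:E = (m k)%:E)%E.

Definition is_density (R : realType) (F : probability (measurableTypeR R) R)
    (f : R -> R) : Prop :=
  [/\ measurable_fun setT f,
      forall x, 0 <= f x
    & forall A : set R, measurable A ->
        F A = (\int[lebesgue_measure]_(x in A) (f x)%:E)%E].

Definition distribution_function (R : realType)
    (F : probability (measurableTypeR R) R) (x : R) : R :=
  fine (F `]-oo, x]%classic).

(* A density is only determined up to null sets, whereas its support and its
   behaviour at the edges are read pointwise; the version [F'] meant is the
   derivative of the distribution function.  Where the latter is not
   differentiable, [derive1] takes the default value [0]. *)
Definition dens (R : realType) (F : probability (measurableTypeR R) R) : R -> R :=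
  derive1 (distribution_function F).

(* Main.v *)
(* Write C(n, k) = [w^k] (1 + w)^n as an integral of ((1+w)^(r+1) / w)^k dw / (i w)
   along the curve on which (1+w)^(r+1) / w is real; it is parametrised by the
   argument p of 1 + w, and x(p) = sin^(r+1)((r+1)p) / (sin p sin^r(rp)) decreases
   from L(r) to 0 on [0, pi/(r+1)].  No contour deformation is needed: the
   integrand is a Laurent polynomial in w, with an explicit primitive.  An
   integration by parts then yields the required moments for the law with tail
   (r+1)p/pi - x(p) f(p) at x(p), whose density is
   f = sin^(r+1)(rp) / (r pi sin^r((r+1)p)).  Compactly supported laws are
   determined by their moments, so this is the given distribution, and both edge
   asymptotics are read off the parametrisation: f x^(r/(r+1)) is continuous at
   p = pi/(r+1), while f / sin p and (L(r) - x) / sin^2 p have positive limits at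
   p = 0. *)
From HB Require Import structures.
Require Import Defs.
From mathcomp Require Import all_boot all_order all_algebra.
From mathcomp Require Import all_classical all_reals all_analysis.
From mathcomp Require Import measurable_realfun ring lra.
Import Order.TTheory GRing.Theory Num.Theory.
Import numFieldNormedType.Exports.
Local Open Scope classical_set_scope.
Local Open Scope ring_scope.

Set Implicit Arguments.
Unset Strict Implicit.

(** The quotients of sines are singular at p = 0, which is one of the two edges, and the density
    blows up at the other. Writing sin (n p) / sin p as a polynomial in cos p makes x(p) and the
    weight smooth on the whole closed interval; it also makes x(p) a rational function of cos p,
    whose nonzero slope at cos p = 1 is the origin of the square root. The product x f replaces f
    wherever p has to reach pi/(r+1).

    The candidate law is never pushed forward to the line: it stays a weight on the p-interval, and
    moments are compared between variables living on two different measure spaces. The outcome is an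
    equality of distribution functions, so the derivative of the given one is known at every
    interior point and not merely almost everywhere.

    Determinacy rests on two facts: moments bounded by K^k confine the mass to a bounded interval,
    and on a bounded interval explicit polynomials approximate the indicators of half-lines. *)

(** * Differentiation rules for functions written pointwise *)

Section DerivativeRules.
Context {R : realType}.
Implicit Types (f g : R -> R) (x : R).

Lemma is_derive_cast f x (a b : R) : is_derive x 1 f a -> a = b ->
  is_derive x 1 f b.
Proof. by move=> ? <-. Qed.

Lemma is_derive1_cst (c : R) x : is_derive x 1 (fun=> c) 0.
Proof. exact: is_derive_cst. Qed.

Lemma is_derive1_id x : is_derive x 1 (fun y : R => y) 1.
Proof. exact: is_derive_id. Qed.

Lemma is_derive1D f g x (a b : R) : is_derive x 1 f a -> is_derive x 1 g b ->
  is_derive x 1 (fun y => f y + g y) (a + b).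
Proof. by move=> ? ?; exact: is_deriveD. Qed.

Lemma is_derive1B f g x (a b : R) : is_derive x 1 f a -> is_derive x 1 g b ->
  is_derive x 1 (fun y => f y - g y) (a - b).
Proof. by move=> ? ?; exact: is_deriveB. Qed.

Lemma is_derive1M f g x (a b : R) : is_derive x 1 f a -> is_derive x 1 g b ->
  is_derive x 1 (fun y => f y * g y) (a * g x + f x * b).
Proof.
by move=> hf hg; apply: is_derive_cast (is_deriveM hf hg) _; rewrite addrC mulrC.
Qed.

Lemma is_derive1X f n x (a : R) : is_derive x 1 f a ->
  is_derive x 1 (fun y => f y ^+ n) (n%:R * f x ^+ n.-1 * a).
Proof.
by move=> hf; have := is_deriveX n hf; rewrite exprfctE.
Qed.

Lemma is_derive1V f x (a : R) : f x != 0 -> is_derive x 1 f a ->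
  is_derive x 1 (fun y => (f y)^-1) (- a / f x ^+ 2).
Proof.
move=> f0 hf; apply: is_derive_cast (is_deriveV f0 hf) _.
by rewrite /GRing.scale /= mulrC mulrN mulNr.
Qed.

Lemma is_derive1_lin (c : R) x : is_derive x 1 (fun y => c * y) c.
Proof.
have := is_derive1M (is_derive1_cst c x) (is_derive1_id x).
by rewrite mul0r add0r mulr1.
Qed.

Lemma is_derive1_chain f g x (a b : R) : is_derive (g x) 1 f a ->
  is_derive x 1 g b -> is_derive x 1 (fun y => f (g y)) (a * b).
Proof. by move=> ? ?; exact: is_derive1_comp. Qed.

Lemma is_derive1_sum (I : Type) (s : seq I) (F : I -> R -> R) (dF : I -> R) x :
  (forall i, is_derive x 1 (F i) (dF i)) ->
  is_derive x 1 (fun y => \sum_(i <- s) F i y) (\sum_(i <- s) dF i).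
Proof.
move=> h; elim: s => [|i s ih].
  rewrite big_nil (_ : (fun y => _) = cst 0); first exact: is_derive_cst.
  by apply/funext => y; rewrite big_nil.
rewrite big_cons (_ : (fun y => _) = (fun y => F i y + \sum_(j <- s) F j y)).
  exact: is_derive1D.
by apply/funext => y; rewrite big_cons.
Qed.

Lemma is_derive1_unique f x (a b : R) :
  is_derive x 1 f a -> is_derive x 1 f b -> a = b.
Proof. by move=> ha hb; rewrite -(@derive_val _ _ _ _ _ _ _ ha) derive_val. Qed.

Lemma is_derive1_continuous f x (a : R) : is_derive x 1 f a ->
  {for x, continuous f}.
Proof.
by move=> h; exact/differentiable_continuous/derivable1_diffP/ex_derive.
Qed.

Lemma is_derive1_FTC (F f : R -> R) (a b : R) : a < b ->
  {in `[a, b], continuous f} ->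
  {in `[a, b], forall x, is_derive x 1 F (f x)} ->
  (\int[lebesgue_measure]_(x in `[a, b]) (f x)%:E = (F b - F a)%:E)%E.
Proof.
move=> ab cf dF; rewrite EFinB; apply: continuous_FTC2 => //.
- by apply: continuous_in_subspaceT => x /set_mem; exact: cf.
- split.
  + by move=> x xab; have := dF x (subset_itv_oo_cc xab); case.
  + apply: cvg_at_right_filter; apply: is_derive1_continuous.
    by apply: dF; rewrite in_itv /= lexx ltW.
  + apply: cvg_at_left_filter; apply: is_derive1_continuous.
    by apply: dF; rewrite in_itv /= lexx ltW.
- move=> x xab; rewrite derive1E.
  by have := dF x (subset_itv_oo_cc xab) => h; rewrite derive_val.
Qed.

End DerivativeRules.

(* Indexed so that [chebU n] is the Chebyshev polynomial U_(n-1), of degree n - 1. *)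
Fixpoint chebU (R : nzRingType) (n : nat) {struct n} : {poly R} :=
  if n is m.+1 then
    if m is k.+1 then 'X *+ 2 * chebU R m - chebU R k else 1
  else 0.

(** * Sine quotients as Chebyshev polynomials, and binomial sums *)

Section Chebyshev.
Context {R : realType}.
Implicit Types (x : R) (n : nat).

Lemma chebUSS n : chebU R n.+2 = 'X *+ 2 * chebU R n.+1 - chebU R n.
Proof. by []. Qed.

Lemma two_step_ind (P : nat -> Prop) : P 0%N -> P 1%N ->
  (forall n, P n -> P n.+1 -> P n.+2) -> forall n, P n.
Proof.
move=> P0 P1 PS n; suff: P n /\ P n.+1 by case.
by elim: n => [//|n [h1 h2]]; split=> //; exact: PS.
Qed.

Lemma chebU1 n : (chebU R n).[1] = n%:R.
Proof.
elim/two_step_ind: n => [||n h1 h2]; rewrite ?chebUSS /= ?hornerE // h1 h2.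
by rewrite -!natr1; lra.
Qed.

(** The recurrence is differentiated at 1. These values give the slope of x as a function of cos p
    at the edge L(r); the factor 3 avoids a division. *)
Lemma deriv_chebU1 n : 3 * (chebU R n)^`().[1] = n%:R ^+ 3 - n%:R.
Proof.
elim/two_step_ind: n => [||n h1 h2].
- by rewrite /= deriv0 horner0; lra.
- by rewrite /= derivC horner0; lra.
- rewrite chebUSS derivB derivM derivMn derivX.
  rewrite !(hornerD, hornerN, hornerM, hornerMn, hornerC, hornerX) chebU1.
  by move: h1 h2; rewrite -!natr1; nra.
Qed.

(* sin (n x) / sin x, extended through the zeros of [sin]. *)
Definition sin_ratio n x := (chebU R n).[cos x].

Lemma sin_natr n x : sin (n%:R * x) = sin x * sin_ratio n x.
Proof.
elim/two_step_ind: n => [||n h1 h2]; rewrite /sin_ratio.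
- by rewrite mul0r sin0 horner0 mulr0.
- by rewrite mul1r hornerE mulr1.
- rewrite chebUSS !(hornerD, hornerN, hornerM, hornerMn, hornerX).
  have -> : n.+2%:R * x = n.+1%:R * x + x by rewrite -!natr1; ring.
  have e : n%:R * x = n.+1%:R * x - x by rewrite -!natr1; ring.
  move: h1; rewrite e sinB sinD => h1.
  by rewrite mulrBr -/(sin_ratio n x) -h1 mulrCA -/(sin_ratio n.+1 x) -h2; ring.
Qed.

(** This is the addition formula for sin ((n+1) x) divided by sin x; induction along the recurrence
    makes it hold at the zeros of [sin] too. *)
Lemma sin_ratioS n x : sin_ratio n.+1 x = cos (n%:R * x) + cos x * sin_ratio n x.
Proof.
elim: n => [|n ih]; first by rewrite /sin_ratio mul0r cos0 !hornerE ?mulr0 ?addr0.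
have -> : n.+1%:R * x = n%:R * x + x by rewrite -!natr1; ring.
rewrite cosD sin_natr.
have -> : sin_ratio n.+2 x = 2 * cos x * sin_ratio n.+1 x - sin_ratio n x.
  rewrite /sin_ratio chebUSS !(hornerD, hornerN, hornerM, hornerMn, hornerX).
  by ring.
rewrite ih.
by rewrite [sin x * _ * _]mulrAC -expr2 sin2cos2; ring.
Qed.

Definition dsin_ratio n x := - sin x * (chebU R n)^`().[cos x].

Lemma is_derive_sin_ratio n x : is_derive x 1 (sin_ratio n) (dsin_ratio n x).
Proof.
rewrite /dsin_ratio mulrC; apply: is_derive1_chain; exact: is_derive_poly.
Qed.

(** Both sides of [sin_natr] are differentiated, which yields the derivative without touching the
    coefficients of [chebU]. *)
Lemma sin_dsin_ratio n x : sin x * dsin_ratio n x = n%:R * cos (n%:R * x) - cos x * sin_ratio n x.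
Proof.
have h1 : is_derive x 1 (fun y => sin (n%:R * y)) (cos (n%:R * x) * n%:R).
  exact: is_derive1_chain (is_derive1_lin _ _).
have h2 := is_derive1M (is_derive_sin x) (is_derive_sin_ratio n x).
have e : (fun y => sin (n%:R * y)) = (fun y => sin y * sin_ratio n y).
  by apply/funext => y; rewrite sin_natr.
by rewrite e in h1; have := is_derive1_unique h1 h2; lra.
Qed.

Lemma continuous_sin_ratio n : continuous (sin_ratio n).
Proof. by move=> x; exact: is_derive1_continuous (is_derive_sin_ratio n x). Qed.

Lemma sin_ratio0 n : sin_ratio n 0 = n%:R.
Proof. by rewrite /sin_ratio cos0 chebU1. Qed.

Lemma sin_ratio_gt0 n x : (0 < n)%N -> 0 <= x -> n%:R * x < pi -> 0 < sin_ratio n x.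
Proof.
move=> n0; rewrite le_eqVlt => /predU1P[<- _|x0 xpi].
  by rewrite sin_ratio0 ltr0n.
have x1 : x < pi.
  by apply: le_lt_trans xpi; rewrite ler_peMl ?ler1n// ltW.
have sx : 0 < sin x by apply: sin_gt0_pi; rewrite x0.
have : 0 < sin (n%:R * x).
  by apply: sin_gt0_pi; rewrite xpi andbT mulr_gt0// ltr0n.
by rewrite sin_natr pmulr_rgt0.
Qed.

(* With w = e^(i (n+1) x) / sin_ratio n x, the law of sines gives
   1 + w = (sin_ratio n.+1 x / sin_ratio n x) e^(i x): this is the real part of
   e^(i b) times the binomial expansion of (1 + w)^N. *)
Lemma sum_binomial_cos (N : nat) n x b : sin_ratio n x != 0 ->
  \sum_(j < N.+1) 'C(N, j)%:R * (sin_ratio n x ^- j * cos (j%:R * (n.+1%:R * x) + b)) =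
  (sin_ratio n.+1 x / sin_ratio n x) ^+ N * cos (N%:R * x + b).
Proof.
move=> v0; elim: N b => [|N ih] b.
  by rewrite big_ord1 /= bin0 !expr0 invr1 !mul0r !mul1r.
rewrite big_ord_recl /= bin0 expr0 invr1 !mul1r mul0r add0r.
under eq_bigr => j _ do rewrite /bump /= add1n binS natrD mulrDl.
rewrite big_split /= addrA.
have := ih b; rewrite big_ord_recl /= bin0 expr0 invr1 !mul1r mul0r add0r => ihb.
rewrite big_ord_recr /= bin_small // mul0r addr0 ihb.
(* Pascal's rule splits (1 + w)^(N+1) into (1 + w)^N and w (1 + w)^N; the factor w adds (n+1) x to
   the phase, so the induction hypothesis is used at a second value of [b]. *)
transitivity ((sin_ratio n.+1 x / sin_ratio n x) ^+ N * cos (N%:R * x + b) +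
   (sin_ratio n x)^-1 * ((sin_ratio n.+1 x / sin_ratio n x) ^+ N * cos (N%:R * x + (n.+1%:R * x + b)))).
  congr (_ + _); rewrite -ih mulr_sumr; apply: eq_bigr => j _.
  rewrite exprS invfM -natr1 [(j%:R + 1) * _]mulrDl mul1r addrA.
  by ring.
rewrite exprS.
have -> : N%:R * x + (n.+1%:R * x + b) = (N.+1%:R * x + b) + n%:R * x.
  by rewrite -!natr1; ring.
have -> : N%:R * x + b = (N.+1%:R * x + b) - x by rewrite -!natr1; ring.
by move: (_ + b) (_ ^+ N) => al q; rewrite cosB cosD sin_natr sin_ratioS; field.
Qed.

(** A sine is a cosine with phase shifted by - pi / 2, and the phase [b] is free. *)
Lemma sum_binomial_sin (N : nat) n x b : sin_ratio n x != 0 ->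
  \sum_(j < N.+1) 'C(N, j)%:R * (sin_ratio n x ^- j * sin (j%:R * (n.+1%:R * x) + b)) =
  (sin_ratio n.+1 x / sin_ratio n x) ^+ N * sin (N%:R * x + b).
Proof.
move=> v0; have c y : sin y = cos (y - pi / 2).
  by rewrite cosB cos_pihalf sin_pihalf mulr0 mulr1 add0r.
rewrite c -addrA -sum_binomial_cos//.
by apply: eq_bigr => j _; rewrite c addrA.
Qed.

End Chebyshev.

Lemma is_derive1_powratio {R : realType} (u v : R -> R) (n : nat) (x du dv : R) :
  v x != 0 -> is_derive x 1 u du -> is_derive x 1 v dv ->
  is_derive x 1 (fun y => u y ^+ n.+1 / v y ^+ n)
    (u x ^+ n * (n.+1%:R * du * v x - n%:R * u x * dv) / v x ^+ n.+1).
Proof.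
move=> v0 hu hv.
have vn0 m : v x ^+ m != 0 by rewrite expf_neq0.
have hV := @is_derive1V _ (fun y => v y ^+ n) _ _ (vn0 n) (is_derive1X n hv).
apply: is_derive_cast (is_derive1M (is_derive1X n.+1 hu) hV) _ => /=.
(* The power rule produces the exponent [n.-1], so n = 0 is treated apart. *)
clear hV; case: n => [|n] /=; rewrite ?expr0 ?expr1; first by field.
by rewrite !exprS; field; rewrite vn0.
Qed.

(** * The curve, its law in the angle p, and the moments of that law *)

Section FussCurve.
Context {R : realType} (r : nat) (r0 : (0 < r)%N).
Implicit Types p : R.

Let rR : 0 < r%:R :> R. Proof. by rewrite ltr0n. Qed.
Let pi0 : 0 < pi :> R. Proof. exact: pi_gt0. Qed.

(** The first positive zero of [sin_ratio r.+1], hence the end of the curve where x = 0. *)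
Definition fuss_angle : R := pi / r.+1%:R.
(* [fuss_x p] is the value of (1 + w)^(r+1) / w at the point w of argument
   (r + 1) p where it is real, [fuss_xf] is x f(x), [fuss_tail] the mass above x,
   [fuss_weight] the derivative of the tail and [fuss_dens] the density, all at
   x = fuss_x p. *)
Definition fuss_x p := sin_ratio r.+1 p ^+ r.+1 / sin_ratio r p ^+ r.
Definition fuss_weight p := ((r.+1%:R * sin (r%:R * p)) ^+ 2 +
  (cos p * sin_ratio r p - r%:R * cos (r%:R * p)) ^+ 2) / (r%:R * pi).
Definition fuss_xf p := sin (r.+1%:R * p) * sin_ratio r p / (r%:R * pi).
Definition fuss_tail p := r.+1%:R * p / pi - fuss_xf p.
Definition fuss_dens p := sin p * sin_ratio r p ^+ r.+1 / (r%:R * pi * sin_ratio r.+1 p ^+ r).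
Definition fuss_dx p := sin_ratio r.+1 p ^+ r *
  (r.+1%:R * dsin_ratio r.+1 p * sin_ratio r p - r%:R * sin_ratio r.+1 p * dsin_ratio r p) / sin_ratio r p ^+ r.+1.

Lemma fuss_angle_gt0 : 0 < fuss_angle.
Proof. by rewrite divr_gt0// ltr0n. Qed.

Lemma mul_fuss_angle : r.+1%:R * fuss_angle = pi.
Proof. by rewrite /fuss_angle mulrC divfK// pnatr_eq0. Qed.

Lemma fuss_angle_lt_pi : fuss_angle < pi.
Proof. by rewrite ltr_pdivrMr ?ltr0n// ltr_pMr// ltr1n. Qed.

Lemma sin_ratio_gt0_angle p : p \in `[0, fuss_angle] -> 0 < sin_ratio r p.
Proof.
rewrite in_itv /= => /andP[p0 pa]; apply: sin_ratio_gt0 => //.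
rewrite -mul_fuss_angle; apply: (@le_lt_trans _ _ (r%:R * fuss_angle)).
  by rewrite ler_wpM2l// ltW.
by rewrite ltr_pM2r ?fuss_angle_gt0// ltr_nat.
Qed.

Lemma sin_ratioS_gt0_angle p : p \in `[0, fuss_angle[ -> 0 < sin_ratio r.+1 p.
Proof.
rewrite in_itv /= => /andP[p0 pa]; apply: sin_ratio_gt0 => //.
by rewrite -mul_fuss_angle ltr_pM2l // ltr0n.
Qed.

Lemma sin_fuss_angle_gt0 p : p \in `]0, fuss_angle] -> 0 < sin p.
Proof.
rewrite in_itv /= => /andP[p0 pa]; apply: sin_gt0_pi.
by rewrite p0 (le_lt_trans pa)// fuss_angle_lt_pi.
Qed.

Lemma sin_ratioS_angle : sin_ratio r.+1 fuss_angle = 0.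
Proof.
have := @sin_natr R r.+1 fuss_angle; rewrite mul_fuss_angle sinpi => /esym/eqP.
rewrite mulf_eq0 gt_eqF ?sin_fuss_angle_gt0//=; first by move/eqP.
by rewrite in_itv /= fuss_angle_gt0 lexx.
Qed.

(** The derivative collapses to a sum of two squares over r pi, which is what makes the candidate
    law positive. *)
Lemma is_derive_fuss_tail p : is_derive p 1 fuss_tail (fuss_weight p).
Proof.
have h1 := is_derive1M (is_derive1_lin r.+1%:R p) (is_derive1_cst pi^-1 p).
have hs : is_derive p 1 (fun y => sin (r.+1%:R * y)) (cos (r.+1%:R * p) * r.+1%:R).
  exact: is_derive1_chain (is_derive1_lin _ _).
have h2 := is_derive1M (is_derive1M hs (is_derive_sin_ratio r p))
  (is_derive1_cst (r%:R * pi)^-1 p).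
apply: is_derive_cast (is_derive1B h1 h2) _; rewrite /fuss_weight.
have pn0 : (pi : R) != 0 by rewrite gt_eqF.
have rn0 : (r%:R : R) != 0 by rewrite gt_eqF.
have e : r.+1%:R * p = p + r%:R * p by rewrite -natr1; ring.
rewrite !mulr0 !addr0 e sinD cosD !sin_natr.
have d := sin_dsin_ratio r p.
have eb := cos2Dsin2 (r%:R * p); rewrite sin_natr in eb.
have ea := cos2Dsin2 p.
rewrite -natr1.
move: (sin p) (cos p) (cos (r%:R * p)) (sin_ratio r p) (dsin_ratio r p) d eb ea => s c C v w d eb ea.
(* The derivative [w] only occurs multiplied by [s], so [d] eliminates it; what remains is an
   identity modulo the two Pythagorean relations. *)
have -> : (s * C + c * (s * v)) * w = (C + c * v) * (r%:R * C - c * v).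
  by rewrite -d; ring.
have e1 : C ^+ 2 = 1 - s ^+ 2 * v ^+ 2 by rewrite -eb; ring.
have e2 : c ^+ 2 = 1 - s ^+ 2 by rewrite -ea; ring.
move: (pi : R) pn0 => q q0; field: e1 e2.
by rewrite q0.
Qed.

Lemma is_derive_fuss_x p : sin_ratio r p != 0 -> is_derive p 1 fuss_x (fuss_dx p).
Proof. by move=> v0; apply: is_derive1_powratio => //; exact: is_derive_sin_ratio. Qed.

Lemma fuss_weight_ge0 p : 0 <= fuss_weight p.
Proof. by rewrite divr_ge0 ?addr_ge0 ?sqr_ge0// mulr_ge0 ?ltW. Qed.

Lemma fuss_weight_gt0 p : p \in `]0, fuss_angle] -> 0 < fuss_weight p.
Proof.
move=> pa; rewrite divr_gt0 ?mulr_gt0// ltr_wpDr ?sqr_ge0// exprn_gt0//.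
by rewrite mulr_gt0 ?ltr0n// sin_natr mulr_gt0 ?sin_fuss_angle_gt0 ?sin_ratio_gt0_angle//;
  exact: subset_itv_oc_cc pa.
Qed.

(** Multiplication by [sin p] makes the derivatives of both sine quotients explicit, and the same
    sum of squares appears as in the derivative of the tail. This common factor is why the density
    is a plain quotient of sines. *)
Lemma sin_fuss_dx p : sin_ratio r p != 0 ->
  sin p * fuss_dx p = - (r%:R * pi * fuss_weight p * sin_ratio r.+1 p ^+ r / sin_ratio r p ^+ r.+1).
Proof.
move=> v0; have pn0 : (pi : R) != 0 by rewrite gt_eqF.
have rn0 : (r%:R : R) != 0 by rewrite gt_eqF.
have d := sin_dsin_ratio r p; have d1 := sin_dsin_ratio r.+1 p.
have e : r.+1%:R * p = p + r%:R * p by rewrite -natr1; ring.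
have eV := sin_ratioS r p.
rewrite e cosD sin_natr in d1.
have -> : r%:R * pi * fuss_weight p =
    (r.+1%:R * (sin p * sin_ratio r p)) ^+ 2 +
    (cos p * sin_ratio r p - r%:R * cos (r%:R * p)) ^+ 2.
  by rewrite /fuss_weight sin_natr mulrC divfK// mulf_neq0.
rewrite /fuss_dx.
transitivity (sin_ratio r.+1 p ^+ r * (r.+1%:R * (sin p * dsin_ratio r.+1 p) * sin_ratio r p
    - r%:R * sin_ratio r.+1 p * (sin p * dsin_ratio r p)) / sin_ratio r p ^+ r.+1); first by ring.
rewrite d d1.
have -> : forall X Y Z : R, - (X * Y / Z) = Y * (- X) / Z by move=> *; ring.
congr (_ * _ / _); rewrite eV -natr1.
by ring.
Qed.

(** The relation x' f = - weight multiplied by x: this form survives at [fuss_angle], where f itself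
    is singular, and so serves the integration by parts on the closed interval. *)
Lemma fuss_dx_fuss_xf p : sin_ratio r p != 0 -> fuss_dx p * fuss_xf p = - (fuss_weight p * fuss_x p).
Proof.
move=> v0; have pn0 : (pi : R) != 0 by rewrite gt_eqF.
have rn0 : (r%:R : R) != 0 by rewrite gt_eqF.
rewrite /fuss_xf sin_natr.
have -> : fuss_dx p * (sin p * sin_ratio r.+1 p * sin_ratio r p / (r%:R * pi)) =
  (sin p * fuss_dx p) * (sin_ratio r.+1 p * sin_ratio r p / (r%:R * pi)) by ring.
rewrite sin_fuss_dx// /fuss_x !exprS.
move: (pi : R) pn0 => q q0; field.
by rewrite q0 expf_neq0// rn0.
Qed.

Lemma fuss_dx_fuss_dens p : sin_ratio r p != 0 -> sin_ratio r.+1 p != 0 -> fuss_dx p * fuss_dens p = - fuss_weight p.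
Proof.
move=> v0 v1; have pn0 : (pi : R) != 0 by rewrite gt_eqF.
have rn0 : (r%:R : R) != 0 by rewrite gt_eqF.
have -> : fuss_dx p * fuss_dens p =
  (sin p * fuss_dx p) * (sin_ratio r p ^+ r.+1 / (r%:R * pi * sin_ratio r.+1 p ^+ r)).
  by rewrite /fuss_dens; ring.
rewrite sin_fuss_dx//.
have vr : sin_ratio r p ^+ r.+1 != 0 by rewrite expf_neq0.
have vr1 : sin_ratio r.+1 p ^+ r != 0 by rewrite expf_neq0.
move: (pi : R) (sin_ratio r p ^+ r.+1) (sin_ratio r.+1 p ^+ r) pn0 vr vr1 => q X Y q0 X0 Y0.
by field; rewrite q0 rn0 X0 Y0.
Qed.

(* Im w^(j-k) / (j - k) where w = e^(i (r+1) p) / sin_ratio r p, and arg w if j = k. *)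
Definition laurent_term (k j : nat) p :=
  if j == k then r.+1%:R * p
  else expR ((k%:R - j%:R) * ln (sin_ratio r p)) *
       sin ((j%:R - k%:R) * (r.+1%:R * p)) / (j%:R - k%:R).

Definition laurent_primitive (k : nat) p :=
  \sum_(j < (r.+1 * k).+1) 'C(r.+1 * k, j)%:R * laurent_term k j p.

(** The derivative of Im w^m / m is Im (w^m w'/w), where w'/w = i (r+1) - v'/v with v =
    [sin_ratio r p]; the case j = k is m = 0. *)
Lemma is_derive_laurent_term k j p : 0 < sin_ratio r p ->
  is_derive p 1 (laurent_term k j) (sin_ratio r p ^+ k * (sin_ratio r p ^- j *
   (r.+1%:R * cos ((j%:R - k%:R) * (r.+1%:R * p)) -
    dsin_ratio r p / sin_ratio r p * sin ((j%:R - k%:R) * (r.+1%:R * p))))).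
Proof.
move=> v0; have vn0 : sin_ratio r p != 0 by rewrite gt_eqF.
rewrite /laurent_term; case: eqP => [->|/eqP jk].
  apply: is_derive_cast (is_derive1_lin _ _) _.
  by rewrite subrr mul0r cos0 sin0 mulr0 subr0 mulr1 mulVKf// expf_neq0.
have d0 : j%:R - k%:R != 0 :> R by rewrite subr_eq0 eqr_nat.
have hl := is_derive1_chain (is_derive1_ln v0) (is_derive_sin_ratio r p).
have he := is_derive1_chain (is_derive_expR _)
  (is_derive1M (is_derive1_cst (k%:R - j%:R) p) hl).
have hs := is_derive1_chain (is_derive_sin _)
  (is_derive1M (is_derive1_cst (j%:R - k%:R) p) (is_derive1_lin r.+1%:R p)).
apply: is_derive_cast (is_derive1M (is_derive1M he hs)
  (is_derive1_cst (j%:R - k%:R)^-1 p)) _.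
have -> : expR ((k%:R - j%:R) * ln (sin_ratio r p)) = sin_ratio r p ^+ k / sin_ratio r p ^+ j.
  by rewrite mulrBl expRB !expRM_natl !lnK.
have vj : sin_ratio r p ^+ j != 0 by rewrite expf_neq0.
by field; rewrite vn0 vj d0.
Qed.

(** The terms sum to the imaginary part of (1 + w)^((r+1) k) w^(-k) w'/w. The first two factors give
    the real number x^k, so only the imaginary part r + 1 of w'/w is left. *)
Lemma is_derive_laurent_primitive k p : 0 < sin_ratio r p ->
  is_derive p 1 (laurent_primitive k) (r.+1%:R * fuss_x p ^+ k).
Proof.
move=> v0; have vn0 : sin_ratio r p != 0 by rewrite gt_eqF.
have hj (j : 'I_(r.+1 * k).+1) := is_derive1M
  (is_derive1_cst 'C(r.+1 * k, j)%:R p) (is_derive_laurent_term k j v0).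
apply: is_derive_cast (is_derive1_sum _ hj) _.
pose b := - (k%:R * (r.+1%:R * p)).
have hc := sum_binomial_cos (r.+1 * k) b vn0.
have hs := sum_binomial_sin (r.+1 * k) b vn0.
transitivity (sin_ratio r p ^+ k * (r.+1%:R *
    (\sum_(j < (r.+1 * k).+1) 'C(r.+1 * k, j)%:R *
      (sin_ratio r p ^- j * cos (j%:R * (r.+1%:R * p) + b))) - dsin_ratio r p / sin_ratio r p *
    (\sum_(j < (r.+1 * k).+1) 'C(r.+1 * k, j)%:R *
      (sin_ratio r p ^- j * sin (j%:R * (r.+1%:R * p) + b))))).
  rewrite !mulr_sumr -sumrB mulr_sumr; apply: eq_bigr => j _.
  by rewrite mul0r add0r mulrBl; ring.
rewrite hc hs.
(* The phases cancel: this is the reality of (1 + w)^(r+1) / w on the curve. *)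
have -> : (r.+1 * k)%:R * p + b = 0 by rewrite /b natrM; ring.
rewrite cos0 sin0 !mulr0 subr0 mulr1 /fuss_x mulrCA; congr (_ * _).
rewrite exprM -exprMn; congr (_ ^+ _).
by rewrite expr_div_n [sin_ratio r p ^+ r.+1]exprS; field; rewrite vn0 expf_neq0.
Qed.

Lemma laurent_primitive0 k : laurent_primitive k 0 = 0.
Proof.
rewrite /laurent_primitive big1// => j _; rewrite /laurent_term; case: ifP => _.
  by rewrite !mulr0.
by rewrite !mulr0 sin0 mulr0 mul0r mulr0.
Qed.

(** At this end w is a negative real number: its powers have no imaginary part, and only the term j
    = k, where arg w = pi, contributes. *)
Lemma laurent_primitive_fuss_angle k : laurent_primitive k fuss_angle = 'C(r.+1 * k, k)%:R * pi.
Proof.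
have hs n : sin (n%:R * pi : R) = 0.
  elim: n => [|n ih]; first by rewrite mul0r sin0.
  by rewrite -natr1 mulrDl mul1r sinDpi ih oppr0.
have kN : (k < (r.+1 * k).+1)%N by rewrite ltnS leq_pmull.
rewrite /laurent_primitive (bigD1 (Ordinal kN))//= {1}/laurent_term eqxx mul_fuss_angle big1 ?addr0//.
move=> j /eqP jk; rewrite /laurent_term ifF; last first.
  by apply/eqP => e; apply: jk; exact: val_inj.
by rewrite mul_fuss_angle [_ * pi]mulrBl sinB !hs !(mul0r, mulr0) subrr !(mul0r, mulr0).
Qed.

Lemma fuss_xf0 : fuss_xf 0 = 0. Proof. by rewrite /fuss_xf mulr0 sin0 !mul0r. Qed.

Lemma fuss_xf_fuss_angle : fuss_xf fuss_angle = 0.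
Proof. by rewrite /fuss_xf mul_fuss_angle sinpi !mul0r. Qed.

Lemma continuous_fuss_weight : continuous fuss_weight.
Proof.
have cs n x : {for x, continuous (fun y : R => sin (n%:R * y))}.
  exact: is_derive1_continuous (is_derive1_chain (is_derive_sin _)
    (is_derive1_lin _ _)).
have cc n x : {for x, continuous (fun y : R => cos (n%:R * y))}.
  exact: is_derive1_continuous (is_derive1_chain (is_derive_cos _)
    (is_derive1_lin _ _)).
move=> x; apply: cvgM; last exact: cvg_cst.
apply: cvgD.
  apply: (@cvg_comp _ _ _ (fun y => r.+1%:R * sin (r%:R * y)) (fun y => y ^+ 2)).
    by apply: cvgM; [exact: cvg_cst|exact: cs].
  exact: exprn_continuous.
apply: (@cvg_comp _ _ _ (fun y => cos y * sin_ratio r y - r%:R * cos (r%:R * y))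
  (fun y => y ^+ 2)); last exact: exprn_continuous.
apply: cvgB; apply: cvgM.
- exact: continuous_cos.
- exact: continuous_sin_ratio.
- exact: cvg_cst.
- exact: cc.
Qed.

(** The weight is (r+1)/pi - (x f)'. Integrating x^k (x f)' by parts, the boundary terms vanish with
    x f, and x' (x f) = - weight x turns the remaining integral into k times the one sought; hence
    the factor 1/(k+1). [Psi] is the resulting primitive. *)
Lemma integral_fuss_x k :
  (\int[lebesgue_measure]_(p in `[0%R, fuss_angle]) (fuss_x p ^+ k * fuss_weight p)%:E =
   ('C(r.+1 * k, k)%:R / k.+1%:R)%:E)%E.
Proof.
pose Psi p := (laurent_primitive k p * pi^-1 - fuss_x p ^+ k * fuss_xf p) / k.+1%:R.
have k1 : k.+1%:R != 0 :> R by rewrite pnatr_eq0.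
have pn0 : (pi : R) != 0 by rewrite gt_eqF.
rewrite (@is_derive1_FTC _ Psi _ 0 fuss_angle fuss_angle_gt0).
- rewrite /Psi laurent_primitive0 laurent_primitive_fuss_angle fuss_xf0 fuss_xf_fuss_angle !mulr0 mul0r !subr0 mul0r subr0.
  by rewrite mulfK.
- move=> p /sin_ratio_gt0_angle v0; apply: cvgM; last exact: continuous_fuss_weight.
  apply: is_derive1_continuous (is_derive1X k (is_derive_fuss_x _)).
  by rewrite gt_eqF.
- move=> p /sin_ratio_gt0_angle v0; have vn0 : sin_ratio r p != 0 by rewrite gt_eqF.
  have hB : is_derive p 1 fuss_xf (r.+1%:R / pi - fuss_weight p).
    have := is_derive1B (is_derive1M (is_derive1_lin r.+1%:R p)
      (is_derive1_cst pi^-1 p)) (is_derive_fuss_tail p).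
    rewrite mulr0 addr0 (_ : (fun y => _) = fuss_xf)//.
    by apply/funext => y; rewrite /fuss_tail opprB addrCA subrr addr0.
  have hS := is_derive1M (is_derive_laurent_primitive k v0) (is_derive1_cst pi^-1 p).
  have hx := is_derive1M (is_derive1X k (is_derive_fuss_x vn0)) hB.
  apply: is_derive_cast (is_derive1M (is_derive1B hS hx)
    (is_derive1_cst k.+1%:R^-1 p)) _.
  have e : k%:R * fuss_x p ^+ k.-1 * fuss_dx p * fuss_xf p = - (k%:R * fuss_x p ^+ k * fuss_weight p).
    rewrite -mulrA fuss_dx_fuss_xf//; case: k {Psi k1 hS hx} => [|k] /=.
      by rewrite !mul0r oppr0.
    by rewrite exprS; ring.
  rewrite e -natr1 in k1 *.
  by move: (pi : R) pn0 => q q0; field; rewrite q0 k1.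
Qed.

End FussCurve.

(** * Polynomials approximating the indicator of a half-line *)

Section ThresholdPolynomials.
Context {R : realType}.

Lemma bernoulli_ge (x : R) n : -1 <= x -> 1 + n%:R * x <= (1 + x) ^+ n.
Proof.
move=> x1; elim: n => [|n ih]; first by rewrite mul0r addr0.
rewrite exprS -natr1; have n0 : 0 <= n%:R :> R by [].
by have := sqr_ge0 x; rewrite expr2; nra.
Qed.

(* The polynomials (1 - z^n)^N with N close to q^-n have a threshold at q. *)
Lemma threshold_unit (u v e : R) : 0 < u -> u < v -> v < 1 -> 0 < e ->
  exists n N, forall z, 0 <= z <= 1 ->
    (z <= u -> 1 - e <= (1 - z ^+ n) ^+ N) /\ (v <= z -> (1 - z ^+ n) ^+ N <= e).
Proof.
move=> u0 uv v1 e0; have [q uq qv] : exists2 q, u < q & q < v.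
  by exists ((u + v) / 2); lra.
have q0 : 0 < q by rewrite (lt_trans u0).
have q1 : q < 1 by rewrite (lt_trans qv).
have v0 : 0 < v by rewrite (lt_trans q0).
have c1 : (u / q) ^+ n @[n --> \oo] --> 0.
  apply: (@cvg_expr _ (u / q)); rewrite ger0_norm ?divr_ge0 ?(ltW u0) ?(ltW q0)//.
  by rewrite ltr_pdivrMr// mul1r.
have c2 : (q / v) ^+ n @[n --> \oo] --> 0.
  apply: (@cvg_expr _ (q / v)); rewrite ger0_norm ?divr_ge0 ?(ltW v0) ?(ltW q0)//.
  by rewrite ltr_pdivrMr// mul1r.
have e20 : 0 < e / 2 by rewrite divr_gt0.
have : \forall n \near \oo, (u / q) ^+ n <= e / 2 /\ (q / v) ^+ n <= e.
  by apply: filterI; [exact: (cvgr_le 0 c1)|exact: (cvgr_le 0 c2)].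
case=> n _ /(_ n (leqnn n))[hu hv].
(* N lies between q^-n and q^-n + 1 <= 2 q^-n, so N u^n is at most 2 (u/q)^n, which is small, while
   N v^n is at least (v/q)^n, which is large. *)
pose N := (Num.trunc (q ^- n)).+1; exists n, N => z /andP[z0 z1].
have qn0 : 0 < q ^+ n by rewrite exprn_gt0.
have qn1 : q ^+ n <= 1 by rewrite exprn_ile1// ltW.
have zn0 : 0 <= z ^+ n by rewrite exprn_ge0.
have zn1 : z ^+ n <= 1 by rewrite exprn_ile1.
have /andP[N1 N2] := truncn_itv (ltW (eqbRL (invr_gt0 _) qn0)).
have {}N1 : N%:R <= q ^- n + 1 by rewrite /N -natr1 lerD2r.
have {}N2 : q ^- n <= N%:R by exact: ltW.
split=> hz.
- have /= := @bernoulli_ge (- z ^+ n) N _; rewrite lerN2 => /(_ zn1).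
  apply: le_trans; rewrite mulrN lerD2l lerN2.
  have zu : z ^+ n <= u ^+ n by rewrite lerXn2r// nnegrE// ltW.
  apply: (@le_trans _ _ ((q ^- n + q ^- n) * u ^+ n)).
    apply: ler_pM => //; rewrite (le_trans N1)// lerD2l.
    by rewrite invf_ge1.
  by move: hu; rewrite expr_div_n mulrDl mulrC; lra.
(* Since (1 - z^n)^N (1 + z^n)^N <= 1, it suffices that the second factor be large, and Bernoulli
   bounds it below by N z^n. *)
- have Nz : (v / q) ^+ n <= (1 + z ^+ n) ^+ N.
    have zn : -1 <= z ^+ n by lra.
    apply: le_trans (bernoulli_ge N zn).
    apply: (@le_trans _ _ (N%:R * z ^+ n)); last by lra.
    rewrite expr_div_n mulrC; apply: ler_pM => //.
    + by rewrite invr_ge0 ltW.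
    + by rewrite exprn_ge0 // ltW.
    + by rewrite lerXn2r// nnegrE// ltW.
  have p0 : 0 < (1 + z ^+ n) ^+ N by rewrite exprn_gt0//; lra.
  rewrite -(ler_pM2r p0) -exprMn.
  apply: (@le_trans _ _ 1).
    apply: exprn_ile1; first by apply: mulr_ge0; lra.
    by have := sqr_ge0 (z ^+ n); rewrite expr2; lra.
  rewrite -ler_pdivrMl// mulr1; apply: le_trans Nz.
  rewrite -[leRHS]invrK lef_pV2 ?posrE// ?invr_gt0 ?exprn_gt0 ?divr_gt0//.
  by rewrite -exprVn invf_div.
Qed.

(** An affine map carries [-M, M] to [0, 1]; adding e / 2 lifts the values left of s to at least 1,
    so that the polynomial majorises the indicator of the half-line. *)
Lemma threshold_poly (M s t e : R) : - M < s -> s < t -> t < M -> 0 < e ->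
  exists p : {poly R}, forall y, `|y| <= M ->
    [/\ 0 <= p.[y] <= 1 + e, (y <= s -> 1 <= p.[y]) & (t <= y -> p.[y] <= e)].
Proof.
move=> Ms st tM e0.
have M0 : 0 < M by lra.
pose h y : R := (y + M) / (2 * M).
have M20 : 0 < 2 * M by lra.
have mono y z : (h y < h z) = (y < z) by rewrite ltr_pM2r ?invr_gt0// ltrD2r.
have moe y z : (h y <= h z) = (y <= z) by rewrite ler_pM2r ?invr_gt0// lerD2r.
have hM : h M = 1 by rewrite /h; field; lra.
have hNM : h (- M) = 0 by rewrite /h addNr mul0r.
have e20 : 0 < e / 2 by rewrite divr_gt0.
have [||| n [N hN]] := @threshold_unit (h s) (h t) (e / 2) _ _ _ e20.
- by rewrite -hNM mono.
- by rewrite mono.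
- by rewrite -hM mono.
exists ((1 - ((2 * M)^-1 *: ('X + M%:P)) ^+ n) ^+ N + (e / 2)%:P) => y yM.
have -> : ((1 - ((2 * M)^-1 *: ('X + M%:P)) ^+ n) ^+ N + (e / 2)%:P).[y] =
    (1 - h y ^+ n) ^+ N + e / 2.
  by rewrite !hornerE mulrC.
have h01 : 0 <= h y <= 1.
  by move: yM; rewrite ler_norml -hNM -hM !moe.
have [h1 h2] := hN _ h01; case/andP: h01 => h0 h1'.
have b0 : 0 <= 1 - h y ^+ n by rewrite subr_ge0 exprn_ile1.
have b1 : 1 - h y ^+ n <= 1 by rewrite lerBlDr lerDl exprn_ge0.
have c0 : 0 <= (1 - h y ^+ n) ^+ N by rewrite exprn_ge0.
have c1 : (1 - h y ^+ n) ^+ N <= 1 by rewrite exprn_ile1.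
split; first by lra.
- by rewrite -moe => /h1; lra.
- by rewrite -moe => /h2; lra.
Qed.

End ThresholdPolynomials.

(** * Comparison of bounded variables with equal moments *)

Section MomentLaws.
Context {R : realType}.

(* The law of X under the measure with density w with respect to mu on D. *)
Definition moment_law d (T : measurableType d) (mu : {measure set T -> \bar R})
    (D : set T) (X w : T -> R) (M : R) (m : nat -> R) : Prop :=
  [/\ measurable D, measurable_fun D X, measurable_fun D w,
    forall x, D x -> 0 <= w x /\ `|X x| <= M
  & forall k, (\int[mu]_(x in D) (X x ^+ k * w x)%:E = (m k)%:E)%E].

Section one_law.
Context d (T : measurableType d) (mu : {measure set T -> \bar R}).
Variables (D : set T) (X w : T -> R) (M : R) (m : nat -> R).
Hypothesis law : moment_law mu D X w M m.

Let mD : measurable D. Proof. by case: law. Qed.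
Let mX : measurable_fun D X. Proof. by case: law. Qed.
Let mw : measurable_fun D w. Proof. by case: law. Qed.
Let w0 x : D x -> 0 <= w x. Proof. by case: law => _ _ _ h _ /h[]. Qed.
Let XM x : D x -> `|X x| <= M. Proof. by case: law => _ _ _ h _ /h[]. Qed.

Lemma moment_law_mass : (\int[mu]_(x in D) (w x)%:E = (m 0)%:E)%E.
Proof.
case: law => _ _ _ _ <-; apply: eq_integral => x _.
by rewrite expr0 mul1r.
Qed.

Lemma moment_law_integrable_weight : mu.-integrable D (EFin \o w).
Proof.
apply/integrableP; split; first exact/measurable_EFinP.
rewrite (eq_integral (fun x => (w x)%:E)).
  by rewrite moment_law_mass ltry.
by move=> x /set_mem /w0 wx /=; rewrite ger0_norm.
Qed.

Lemma moment_law_measurable_horner (p : {poly R}) :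
  measurable_fun D (fun x => p.[X x] * w x).
Proof.
apply: measurable_funM => //.
apply: (measurableT_comp _ mX) => //.
by apply: continuous_measurable_fun; exact: continuous_horner.
Qed.

Lemma moment_law_integrable k :
  mu.-integrable D (fun x => (X x ^+ k * w x)%:E).
Proof.
have hM : mu.-integrable D (fun x => ((M ^+ k)%:E * (w x)%:E)%E).
  exact: integrableZl moment_law_integrable_weight.
apply: le_integrable hM => //.
  apply/measurable_EFinP/measurable_funM => //; exact: measurable_funX.
move=> x Dx /=; rewrite lee_fin !normrM ler_wpM2r// !normrX.
have M0 : 0 <= M by apply: le_trans (XM Dx).
by rewrite [`|M|]ger0_norm// lerXn2r ?nnegrE// XM.
Qed.

Lemma moment_law_horner (p : {poly R}) :
  (\int[mu]_(x in D) (p.[X x] * w x)%:E = (\sum_(i < size p) p`_i * m i)%:E)%E.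
Proof.
transitivity (\int[mu]_(x in D)
    (\sum_(i < size p) ((p`_i)%:E * (X x ^+ i * w x)%:E))%E)%E.
  apply: eq_integral => x _; rewrite horner_coef mulr_suml sumEFin.
  by congr EFin; apply: eq_bigr => i _; rewrite mulrA.
rewrite integral_sum//; last first.
  by move=> i; apply: integrableZl => //; exact: moment_law_integrable.
rewrite -sumEFin; apply: eq_bigr => i _.
rewrite integralZl//; last exact: moment_law_integrable.
by case: law => _ _ _ _ ->.
Qed.

End one_law.

Lemma moment_law_le_bound d (T : measurableType d)
    (mu : {measure set T -> \bar R}) D X w M M' m : M <= M' ->
  moment_law mu D X w M m -> moment_law (T := T) mu D X w M' m.
Proof.
move=> MM' [? ? ? h ?]; split=> // x /h[? XM]; split=> //.
exact: le_trans MM'.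
Qed.

(* Integrate a polynomial that is close to the indicator of ]-oo, s] on ]-oo, s]
   and on [t, +oo[. *)
Lemma moment_law_cdf_le d1 (T1 : measurableType d1) d2 (T2 : measurableType d2)
    (mu1 : {measure set T1 -> \bar R}) (mu2 : {measure set T2 -> \bar R})
    D1 X1 w1 M1 D2 X2 w2 M2 (m : nat -> R) (s t : R) : m 0 = 1 ->
  moment_law mu1 D1 X1 w1 M1 m -> moment_law mu2 D2 X2 w2 M2 m -> s < t ->
  (\int[mu1]_(x in D1 `&` [set x | (X1 x <= s)%R]) (w1 x)%:E <=
   \int[mu2]_(x in D2 `&` [set x | (X2 x <= t)%R]) (w2 x)%:E)%E.
Proof.
move=> m0 law1 law2 st.
(* A common bound for both variables, large enough that s and t lie strictly inside ]-M, M[. *)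
pose M : R := `|M1| + `|M2| + `|s| + `|t| + 1.
have n1 := normr_ge0 M1; have n2 := normr_ge0 M2.
have n3 := normr_ge0 s; have n4 := normr_ge0 t.
have := ler_norm M1; have := ler_norm M2.
have := ler_norm (- s); rewrite normrN; have := ler_norm t => a1 a2 a3 a4.
have {}law1 : moment_law mu1 D1 X1 w1 M m.
  by apply: moment_law_le_bound law1; rewrite /M; lra.
have {}law2 : moment_law mu2 D2 X2 w2 M m.
  by apply: moment_law_le_bound law2; rewrite /M; lra.
apply/lee_addgt0Pr => e e0.
have Ms : - M < s by rewrite /M; lra.
have tM : t < M by rewrite /M; lra.
have [p hp] := threshold_poly Ms st tM e0.
have [mD1 mX1 mw1 h1 _] := law1; have [mD2 mX2 mw2 h2 _] := law2.
have mA1 : measurable (D1 `&` [set x | (X1 x <= s)%R]).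
  by rewrite -preimage_itvNyc; apply: mX1.
have mA2 : measurable (D2 `&` [set x | (X2 x <= t)%R]).
  by rewrite -preimage_itvNyc; apply: mX2.
have hp1 x : D1 x -> 0 <= p.[X1 x] * w1 x.
  by move=> /h1[w0 /hp[/andP[? _] _ _]]; rewrite mulr_ge0.
have hp2 x : D2 x -> 0 <= p.[X2 x] * w2 x.
  by move=> /h2[w0 /hp[/andP[? _] _ _]]; rewrite mulr_ge0.
have mp1 := moment_law_measurable_horner law1 p.
have mp2 := moment_law_measurable_horner law2 p.
apply: (@le_trans _ _ (\int[mu1]_(x in D1) (p.[X1 x] * w1 x)%:E)%E).
  apply: (@le_trans _ _ (\int[mu1]_(x in D1 `&` [set x | (X1 x <= s)%R])
      (p.[X1 x] * w1 x)%:E)%E).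
    apply: ge0_le_integral => //.
    - by move=> x [/h1[]].
    - apply/measurable_EFinP; exact: measurable_funS mw1.
    - apply/measurable_EFinP; exact: measurable_funS mp1.
    - by move=> x [/h1[w0 /hp[_ hs _]] /= /hs hs1]; rewrite lee_fin ler_peMl.
  by apply: ge0_subset_integral => //; exact/measurable_EFinP.
rewrite (moment_law_horner law1) -(moment_law_horner law2).
(* The total mass is m 0 = 1, so the error e is itself an integral against [w2] and the comparison
   becomes pointwise. *)
have ew : (e%:E = \int[mu2]_(x in D2) (e%:E * (w2 x)%:E))%E.
  rewrite ge0_integralZl_EFin//; last exact: ltW.
  - by rewrite (moment_law_mass law2) m0 mule1.
  - by move=> x /h2[].
  - exact/measurable_EFinP.
set A2 := D2 `&` _ in mA2 *.
have mw2A : measurable_fun D2 (w2 \_ A2).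
  by apply/(measurable_restrict _ mA2 mD2); apply: measurable_funS mw2.
rewrite ew -[A2 in leRHS](@setIidr _ D2 A2); last exact: subIsetl.
rewrite integral_mkcondr restrict_EFin -ge0_integralD//; first last.
- by apply: measurable_funeM; exact/measurable_EFinP.
- by move=> x /h2[w0 _]; rewrite lee_fin mulr_ge0// ltW.
- exact/measurable_EFinP.
- move=> x /h2[w0 _] /=; rewrite lee_fin patchE; by case: ifP.
apply: ge0_le_integral => //.
- exact/measurable_EFinP.
- apply: emeasurable_funD; first exact/measurable_EFinP.
  by apply: measurable_funeM; exact/measurable_EFinP.
- move=> x D2x; have [w0 X2M] := h2 x D2x.
  have [/andP[p0 p1] _ pt] := hp _ X2M.
  rewrite /= -EFinM -EFinD lee_fin patchE; case: ifPn => [_|/negP xA].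
    by rewrite -{2}[w2 x]mul1r -mulrDl ler_wpM2r.
  rewrite add0r ler_wpM2r// pt// leNgt; apply/negP => /ltW xt.
  by apply: xA; rewrite inE.
Qed.

End MomentLaws.

(** * Boundedness of the support and determinacy by moments *)

Section ProbabilityFromMoments.

Context {R : realType}.

(** One bounded law imposes a geometric bound on the moments, which then confines every probability
    measure sharing them. *)
Lemma moment_law_moment_le d (T : measurableType d)
    (mu : {measure set T -> \bar R}) D X w M m k : m 0 = 1 ->
  moment_law (T := T) mu D X w M m -> m k <= M ^+ k.
Proof.
move=> m0 law; have [mD mX mw h hm] := law.
rewrite -lee_fin -hm.
have -> : ((M ^+ k)%:E = \int[mu]_(x in D) ((M ^+ k)%:E * (w x)%:E))%E.
  rewrite integralZl//; last exact: moment_law_integrable_weight law.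
  by rewrite (moment_law_mass law) m0 mule1.
apply: le_integral => //.
- exact: moment_law_integrable law k.
- exact/(integrableZl mD)/(moment_law_integrable_weight law).
- move=> x /set_mem Dx; rewrite -EFinM lee_fin; have [w0 XM] := h _ Dx.
  rewrite ler_wpM2r// (le_trans (ler_norm _))// normrX lerXn2r// nnegrE//.
  exact: le_trans XM.
Qed.

Variables (F : probability (measurableTypeR R) R) (m : nat -> R).
Hypothesis hF : has_moments F m.

(** The moment of order 2k has a nonnegative integrand, so its being a real number is integrability;
    then |x^k| <= 1 + x^(2k). *)
Lemma has_moments_integrable k : F.-integrable setT (fun x : R => (x ^+ k)%:E).
Proof.
have mX n (D : set R) : measurable_fun D (fun x : R => x ^+ n).
  by apply: measurable_funX; exact: measurable_id.
have i2 : F.-integrable setT (fun x : R => (x ^+ (k + k))%:E).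
  apply/integrableP; split; first exact/measurable_EFinP.
  have -> : (\int[F]_x `|(x ^+ (k + k))%:E| = \int[F]_x (x ^+ (k + k))%:E)%E.
    by apply: eq_integral => x _ /=; rewrite ger0_norm// exprD -expr2 sqr_ge0.
  by rewrite hF ltry.
have i1 : F.-integrable setT (fun x : R => (1 + x ^+ (k + k))%:E).
  exact: (integrableD measurableT (finite_measure_integrable_cst F 1 measurableT) i2).
apply: le_integrable i1 => //; first exact/measurable_EFinP.
move=> x _ /=; rewrite lee_fin.
have h : 0 <= x ^+ (k + k) by rewrite exprD -expr2 sqr_ge0.
rewrite [leRHS]ger0_norm ?addr_ge0// exprD -expr2 -[X in _ + X]real_normK ?num_real//.
by have := sqr_ge0 (`|x ^+ k| - 1); have := normr_ge0 (x ^+ k); nra.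
Qed.

Variable K : R.
Hypotheses (K0 : 0 <= K) (mK : forall k, m k <= K ^+ k).

(** The margin 1 above K makes the ratio K / (K + 1) smaller than 1. *)
Let N : set (measurableTypeR R) := [set x : R | K + 1 < `|x|].

Lemma measurable_tail : measurable N.
Proof.
rewrite /N -preimage_itvoy -[X in measurable X]setTI.
by apply: normr_measurable => //; exact: measurable_itv.
Qed.

(** Markov's inequality for x^(2k) bounds the mass by (K / (K + 1))^(2k) for every k. *)
Lemma has_moments_tail : F N = 0%E.
Proof.
have mN := measurable_tail.
have K1 : 0 < K + 1 by rewrite ltr_wpDl.
pose q := K / (K + 1).
have q0 : 0 <= q by rewrite divr_ge0// ltW.
have q1 : q < 1 by rewrite ltr_pdivrMr// mul1r; lra.
have fN : F N \is a fin_num by exact: fin_num_measure.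
have N0 : (0 <= F N)%E by [].
rewrite -(fineK fN); congr EFin; apply/eqP; rewrite eq_le fine_ge0// andbT.
have hk k : fine (F N) <= q ^+ k.
  have h0 (x : R) : 0 <= x ^+ (k + k) by rewrite exprD -expr2 sqr_ge0.
  have h : (((K + 1) ^+ (k + k))%:E * F N <= (m (k + k))%:E)%E.
    rewrite -hF -integral_cst//.
    apply: (@le_trans _ _ (\int[F]_(x in N) (x ^+ (k + k))%:E)%E).
      apply: ge0_le_integral => //.
      - by move=> x _; rewrite lee_fin exprn_ge0// ltW.
      - by apply/measurable_EFinP; apply: measurable_funX; exact: measurable_id.
      - move=> x /= Nx; rewrite lee_fin -[leRHS]ger0_norm// normrX.
        by rewrite lerXn2r ?nnegrE// ltW.
    apply: ge0_subset_integral => //.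
    - by apply/measurable_EFinP; apply: measurable_funX; exact: measurable_id.
    - by move=> x _; rewrite lee_fin.
  have {h}: (K + 1) ^+ (k + k) * fine (F N) <= K ^+ (k + k).
    by rewrite -lee_fin EFinM fineK// (le_trans h)// lee_fin mK.
  rewrite mulrC -ler_pdivlMr ?exprn_gt0// -expr_div_n -/q => /le_trans; apply.
  by rewrite exprD ler_piMr ?exprn_ge0// exprn_ile1// ltW.
have cq : q ^+ n @[n --> \oo] --> 0 by apply: (@cvg_expr _ q); rewrite ger0_norm.
rewrite leNgt; apply/negP => FN0.
have [n _ /(_ n (leqnn n)) /=] := cvgr_lt 0 cq _ FN0.
by rewrite ltNge hk.
Qed.

Lemma has_moments_law :
  moment_law F (~` N) id (cst 1) (K + 1) m.
Proof.
have mN := measurable_tail.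
split.
- exact: measurableC.
- exact: measurable_id.
- exact: measurable_cst.
- by move=> x /= /negP; rewrite -leNgt.
- move=> k; rewrite -hF.
  rewrite (negligible_integral mN _ (has_moments_integrable k))//; last first.
    exact: has_moments_tail.
  by rewrite setTD; apply: eq_integral => x _; rewrite mulr1.
Qed.

Lemma has_moments_cdf (t : R) :
  (F `]-oo, t]%classic = \int[F]_(x in ~` N `&` [set x | (x <= t)%R]) (cst 1 x)%:E)%E.
Proof.
have mN := measurable_tail.
rewrite -[LHS]mul1e -integral_cst//.
have mt : 'measurable (`]-oo, t]%classic : set (measurableTypeR R)).
  exact: measurable_itv.
rewrite (negligible_integral mN mt (finite_measure_integrable_cst F 1 mt)).
  by rewrite setDE setIC set_itvNyc.
exact: has_moments_tail.
Qed.

End ProbabilityFromMoments.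

(** The comparison of laws loses an arbitrarily small gap between thresholds: it bounds the
    distribution function at t by G on either side of t, and continuity of G closes the gap. *)
Lemma cdf_unique {R : realType} (F : probability (measurableTypeR R) R)
    d (T : measurableType d) (mu : {measure set T -> \bar R}) D X w M m
    (G : R -> R) (t : R) :
  has_moments F m -> m 0 = 1 -> moment_law mu D X w M m ->
  (forall s, (\int[mu]_(x in D `&` [set x | (X x <= s)%R]) (w x)%:E = (G s)%:E)%E) ->
  {for t, continuous G} -> distribution_function F t = G t.
Proof.
move=> hF m0 law hG cG.
have law' := moment_law_le_bound (ler_norm M) law.
have mK k := moment_law_moment_le k m0 law'.
have lawF := has_moments_law hF (normr_ge0 M) mK.
have fF s : (F `]-oo, s]%classic = (distribution_function F s)%:E)%E.
  by rewrite /distribution_function fineK// fin_num_measure.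
have h1 s : t < s -> distribution_function F t <= G s.
  move=> ts; rewrite -lee_fin -hG -fF (has_moments_cdf hF (normr_ge0 M) mK).
  exact: moment_law_cdf_le m0 lawF law ts.
have h2 s : s < t -> G s <= distribution_function F t.
  move=> st; rewrite -lee_fin -hG -fF (has_moments_cdf hF (normr_ge0 M) mK).
  exact: moment_law_cdf_le m0 law lawF st.
apply/eqP; rewrite eq_le !leNgt; apply/andP; split; apply/negP => FG.
- have near_lt : \forall s \near t^'+, G s < distribution_function F t.
    exact: (cvgr_lt (G t) (cvg_at_right_filter cG)).
  have [s [ts]] := filter_ex (filterI (nbhs_right_gt t) near_lt).
  by rewrite ltNge h1.
- have near_gt : \forall s \near t^'-, distribution_function F t < G s.
    exact: (cvgr_gt (G t) (cvg_at_left_filter cG)).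
  have [s [st]] := filter_ex (filterI (nbhs_left_lt t) near_gt).
  by rewrite ltNge h2.
Qed.

(** * The inverse of the curve and the explicit distribution function *)

Section FussInverse.
Context {R : realType} (r : nat) (r0 : (0 < r)%N).
Local Notation fa := (@fuss_angle R r).
Local Notation x := (@fuss_x R r).
Local Notation Lr := (L R r).

Let a0 : 0 < fa. Proof. exact: fuss_angle_gt0. Qed.
Let pi0 : 0 < pi :> R. Proof. exact: pi_gt0. Qed.
Let Vn0 p : p \in `[0, fa] -> sin_ratio r p != 0.
Proof. by move=> /(sin_ratio_gt0_angle r0) h; rewrite gt_eqF. Qed.
Let in0 : 0 \in `[0, fa]. Proof. by rewrite in_itv /= lexx ltW. Qed.
Let ina : fa \in `[0, fa]. Proof. by rewrite in_itv /= lexx ltW. Qed.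

Lemma fuss_x0 : x 0 = Lr.
Proof. by rewrite /fuss_x !sin_ratio0. Qed.

Lemma fuss_x_fuss_angle : x fa = 0.
Proof. by rewrite /fuss_x (sin_ratioS_angle r0) exprS !mul0r. Qed.

Lemma continuous_fuss_x p : p \in `[0, fa] -> {for p, continuous x}.
Proof.
by move=> pa; exact: is_derive1_continuous (is_derive_fuss_x (Vn0 pa)).
Qed.

Lemma within_continuous_fuss_x : {within `[0, fa], continuous x}.
Proof.
by apply: continuous_in_subspaceT => p /set_mem; exact: continuous_fuss_x.
Qed.

Lemma fuss_dx_lt0 p : p \in `]0, fa[ -> fuss_dx r p < 0.
Proof.
move=> pa; have pa1 := subset_itv_oo_cc pa; have pa2 := subset_itv_oo_oc pa.
have sp := sin_fuss_angle_gt0 r0 pa2.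
rewrite -(pmulr_rlt0 _ sp) (sin_fuss_dx r0) ?Vn0// oppr_lt0.
rewrite divr_gt0 ?exprn_gt0 ?(sin_ratio_gt0_angle r0)// mulr_gt0 ?exprn_gt0//.
  by apply: mulr_gt0; [rewrite mulr_gt0 ?ltr0n|exact: fuss_weight_gt0].
exact: sin_ratioS_gt0_angle (subset_itv_oo_co pa).
Qed.

Lemma fuss_x_decr : {in `[0, fa] &, {homo x : p q /~ p < q}}.
Proof.
move=> p q; rewrite !in_itv /= => /andP[p0 pa] /andP[q0 qa] pq.
apply: (@ltr0_derive1_decr _ x 0 fa) => //.
- by move=> y /subset_itv_oo_cc/Vn0/is_derive_fuss_x; case.
- move=> y ya; rewrite derive1E.
  have h := is_derive_fuss_x (Vn0 (subset_itv_oo_cc ya)).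
  by rewrite derive_val fuss_dx_lt0.
- exact: within_continuous_fuss_x.
Qed.

Lemma fuss_x_ltP p q : p \in `[0, fa] -> q \in `[0, fa] -> (x p < x q) = (q < p).
Proof.
move=> pa qa; apply/idP/idP => [|qp]; last exact: fuss_x_decr.
case: (ltgtP p q) => [pq|//|->]; last by rewrite ltxx.
by rewrite ltNge ltW// fuss_x_decr.
Qed.

Lemma fuss_x_leP p q : p \in `[0, fa] -> q \in `[0, fa] -> (x p <= x q) = (q <= p).
Proof. by move=> pa qa; rewrite !leNgt fuss_x_ltP. Qed.

Lemma fuss_x_itv p : p \in `[0, fa] -> x p \in `[0, Lr].
Proof.
move=> pa; rewrite in_itv /= -{1}fuss_x_fuss_angle -fuss_x0 !fuss_x_leP//.
by move: pa; rewrite in_itv /= andbC.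
Qed.

Lemma L_gt0 : 0 < Lr.
Proof. by rewrite divr_gt0 ?exprn_gt0 ?ltr0n. Qed.

(** A chosen preimage; the default 0 is taken outside [[0, Lr]], where there is none. *)
Definition fuss_inv (t : R) : R := xget 0 [set p | p \in `[0, fa] /\ x p = t].

Lemma fuss_invP t : t \in `[0, Lr] -> fuss_inv t \in `[0, fa] /\ x (fuss_inv t) = t.
Proof.
move=> tL; rewrite /fuss_inv; case: xgetP => [p -> []//|/= h].
have [|p pa xp] := @IVT _ x 0 fa t (ltW a0) within_continuous_fuss_x.
  rewrite fuss_x0 fuss_x_fuss_angle min_r ?max_l ?(ltW L_gt0)//.
by case: (h p).
Qed.

Lemma fuss_inv_itv t : t \in `[0, Lr] -> fuss_inv t \in `[0, fa].
Proof. by case/fuss_invP. Qed.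

Lemma fuss_xK t : t \in `[0, Lr] -> x (fuss_inv t) = t.
Proof. by case/fuss_invP. Qed.

Lemma fuss_invK p : p \in `[0, fa] -> fuss_inv (x p) = p.
Proof.
move=> pa; have [qa qE] := fuss_invP (fuss_x_itv pa).
by apply/eqP; rewrite eq_le -(fuss_x_leP pa qa) -(fuss_x_leP qa pa) qE lexx.
Qed.

Lemma within_continuous_fuss_inv : {within `[0, Lr], continuous fuss_inv}.
Proof.
rewrite -fuss_x_fuss_angle -fuss_x0; apply: segment_can_ge_continuous.
- exact: ltW.
- exact: within_continuous_fuss_x.
- by move=> p; exact: fuss_invK.
Qed.

Lemma fuss_inv0 : fuss_inv 0 = fa.
Proof. by rewrite -fuss_x_fuss_angle fuss_invK. Qed.

Lemma fuss_invL : fuss_inv Lr = 0.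
Proof. by rewrite -fuss_x0 fuss_invK. Qed.

Lemma fuss_inv_itvoo t : t \in `]0, Lr[ -> fuss_inv t \in `]0, fa[.
Proof.
move=> tL; have tL' := subset_itv_oo_cc tL.
have fi := fuss_inv_itv tL'.
rewrite in_itv /= -(fuss_x_ltP fi in0) -(fuss_x_ltP ina fi) fuss_x0 fuss_x_fuss_angle fuss_xK// andbC.
by move: tL; rewrite in_itv.
Qed.

Lemma is_derive_fuss_inv t : t \in `]0, Lr[ ->
  is_derive t 1 fuss_inv (fuss_dx r (fuss_inv t))^-1.
Proof.
move=> tL; have pa := fuss_inv_itvoo tL.
rewrite -{1}(fuss_xK (subset_itv_oo_cc tL)).
apply: is_derive_inverse.
- near=> p; apply: fuss_invK; apply: subset_itv_oo_cc.
  by near: p; exact: near_in_itvoo.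
- near=> p; apply: continuous_fuss_x; apply: subset_itv_oo_cc.
  by near: p; exact: near_in_itvoo.
- exact/is_derive_fuss_x/Vn0/subset_itv_oo_cc.
- by rewrite lt_eqF// fuss_dx_lt0.
Unshelve. all: by end_near. Qed.

(** Projecting onto [[0, Lr]] turns continuity of the inverse within the interval into continuity on
    the line, and makes the distribution function constant on each side of the support. *)
Definition clamp (t : R) : R := Num.max 0 (Num.min t Lr).

Lemma clamp_itv t : clamp t \in `[0, Lr].
Proof.
by rewrite in_itv /= le_max lexx /= ge_max (ltW L_gt0) ge_min lexx orbT.
Qed.

Lemma clamp_id t : t \in `[0, Lr] -> clamp t = t.
Proof.
by rewrite in_itv /= => /andP[t0 tL]; rewrite /clamp min_l// max_r.
Qed.

Lemma clamp_le0 t : t <= 0 -> clamp t = 0.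
Proof. by move=> t0; rewrite /clamp max_l// ge_min t0. Qed.

Lemma clamp_geL t : Lr <= t -> clamp t = Lr.
Proof. by move=> t0; rewrite /clamp min_r// max_r// ltW// L_gt0. Qed.

Lemma continuous_clamp : continuous clamp.
Proof.
move=> t; have cc (c : R) : {for t, continuous (cst c : R -> R^o)} by exact: cvg_cst.
have ci : {for t, continuous (id : R -> R^o)} by exact: cvg_id.
exact: (continuous_max (cc 0) (continuous_min ci (cc Lr))).
Qed.

Lemma continuous_fuss_inv_clamp : continuous (fun t => fuss_inv (clamp t)).
Proof.
move=> t; have /subspace_continuousP/(_ _ (clamp_itv t)) h := within_continuous_fuss_inv.
apply: (@cvg_comp _ _ _ clamp fuss_inv _ _ _ _ h) => P /=; rewrite /within /nbhs /= => hP.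
have := continuous_clamp hP.
by apply: (@filterS _ (nbhs t)) => s /=; apply; exact: clamp_itv.
Qed.

Definition fuss_cdf (t : R) : R := 1 - fuss_tail r (fuss_inv (clamp t)).

Lemma continuous_fuss_cdf : continuous fuss_cdf.
Proof.
move=> t; apply: cvgB; first exact: cvg_cst.
apply: (@cvg_comp _ _ _ (fun s => fuss_inv (clamp s)) (fuss_tail r)).
  exact: continuous_fuss_inv_clamp.
exact: is_derive1_continuous (is_derive_fuss_tail r0 _).
Qed.

Lemma fuss_tail0 : fuss_tail r 0 = 0 :> R.
Proof. by rewrite /fuss_tail fuss_xf0 mulr0 mul0r subr0. Qed.

Lemma fuss_tail_fuss_angle : fuss_tail r fa = 1.
Proof. by rewrite /fuss_tail fuss_xf_fuss_angle mul_fuss_angle subr0 divff// gt_eqF. Qed.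

Lemma fuss_cdf_le0 t : t <= 0 -> fuss_cdf t = 0.
Proof. by move=> t0; rewrite /fuss_cdf clamp_le0// fuss_inv0 fuss_tail_fuss_angle subrr. Qed.

Lemma fuss_cdf_geL t : Lr <= t -> fuss_cdf t = 1.
Proof. by move=> t0; rewrite /fuss_cdf clamp_geL// fuss_invL fuss_tail0 subr0. Qed.

Lemma fuss_x_law : moment_law lebesgue_measure (`[0, fa] : set R) x (@fuss_weight R r) Lr
  (fun k => 'C(r.+1 * k, k)%:R / k.+1%:R).
Proof.
split.
- exact: measurable_itv.
- apply: subspace_continuous_measurable_fun; first exact: measurable_itv.
  exact: within_continuous_fuss_x.
- by apply: measurable_funTS; apply: continuous_measurable_fun; exact: continuous_fuss_weight.
- move=> p /fuss_x_itv; rewrite in_itv /= => /andP[h1 h2].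
  by rewrite (fuss_weight_ge0 r0)// ger0_norm.
- move=> k; exact: integral_fuss_x r0 k.
Qed.

(** As x decreases, its sublevel sets are final segments of the p-interval, over which the weight
    integrates to a difference of tails. *)
Lemma fuss_x_law_cdf t :
  (\int[lebesgue_measure]_(p in `[0%R, fa] `&` [set p | (x p <= t)%R])
    (@fuss_weight R r p)%:E = (fuss_cdf t)%:E)%E.
Proof.
(* For t < 0 the sublevel set is empty, whereas the description through [clamp] would leave the
   point [fuss_angle]. *)
have [t0|t0] := ltP t 0.
  rewrite fuss_cdf_le0 ?ltW// (_ : _ `&` _ = set0) ?integral_set0//.
  apply/seteqP; split => // p [/= /fuss_x_itv]; rewrite in_itv /= => /andP[h _] h'.
  by move: t0; rewrite ltNge (le_trans h).
have cL := clamp_itv t; have fi := fuss_inv_itv cL.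
have -> : `[0%R, fa] `&` [set p | (x p <= t)%R] = `[fuss_inv (clamp t), fa]%classic.
  have e p : p \in `[0, fa] -> (x p <= t) = (fuss_inv (clamp t) <= p).
    move=> pa; rewrite -(fuss_x_leP pa fi) fuss_xK// /clamp le_max le_min.
    have := fuss_x_itv pa; rewrite in_itv /= => /andP[h1 h2]; rewrite h2 andbT.
    case: (leP (x p) t) => [|tx]; rewrite ?orbT// orbF.
    by apply/esym/negbTE; rewrite -ltNge (le_lt_trans t0).
  apply/seteqP; split => p /=.
    move=> [pa]; rewrite e// in_itv /= => ->.
    by move: pa; rewrite in_itv /= => /andP[].
  rewrite in_itv /= => /andP[h1 h2].
  have pa : p \in `[0, fa].
    by rewrite in_itv /= h2 andbT (le_trans _ h1)//; move: fi; rewrite in_itv => /andP[].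
  by split => //; rewrite e.
have : fuss_inv (clamp t) <= fa by move: fi; rewrite in_itv => /andP[].
rewrite le_eqVlt => /predU1P[e|lt].
  by rewrite /fuss_cdf e set_itv1 integral_set1 fuss_tail_fuss_angle subrr.
rewrite (@is_derive1_FTC _ (fuss_tail r) _ _ _ lt) ?fuss_tail_fuss_angle//.
- by move=> p _; exact: continuous_fuss_weight.
- by move=> p _; exact: is_derive_fuss_tail.
Qed.

Lemma distribution_functionE (F : probability (measurableTypeR R) R) :
  has_moments F (fun k : nat => ('C(r.+1 * k, k))%:R / k.+1%:R) ->
  distribution_function F = fuss_cdf.
Proof.
move=> hF; apply/funext => t.
apply: (cdf_unique hF _ fuss_x_law fuss_x_law_cdf); last exact: continuous_fuss_cdf.
by rewrite muln0 bin0 divr1.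
Qed.

End FussInverse.

(** * Measures determined by their values on rays *)

Section DensityMeasure.
Context {R : realType}.
Variable f : R -> R.
Hypotheses (mf : measurable_fun setT f) (f0 : forall x, 0 <= f x).

Definition density_measure (A : set (measurableTypeR R)) : \bar R :=
  (\int[lebesgue_measure]_(x in A) (f x)%:E)%E.

Let density_measure0 : density_measure set0 = 0%E.
Proof. by rewrite /density_measure integral_set0. Qed.

Let density_measure_ge0 A : (0 <= density_measure A)%E.
Proof. by apply: integral_ge0 => x _; rewrite lee_fin. Qed.

Let density_measure_sigma_additive : semi_sigma_additive density_measure.
Proof.
move=> /= F mF tF mUF; rewrite /density_measure; apply: cvg_toP.
  apply: ereal_nondecreasing_is_cvgn => m n mn.
  apply: lee_sum_nneg_natr => // k _ _; apply: integral_ge0 => /= x Fkx.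
  by rewrite lee_fin.
rewrite ge0_integral_bigcup//=.
- by apply/measurable_funTS/measurable_EFinP.
- by move=> x _; rewrite lee_fin.
Qed.

HB.instance Definition _ := isMeasure.Build _ _ _ density_measure
  density_measure0 density_measure_ge0 density_measure_sigma_additive.

(** The rays are stable under intersection, exhaust the line with finite mass, and generate the
    Borel sets because half-open intervals are differences of rays. *)
Lemma density_of_cdf (F : probability (measurableTypeR R) R) :
  (forall t, F `]-oo, t]%classic =
    (\int[lebesgue_measure]_(x in `]-oo, t]) (f x)%:E)%E) ->
  forall A : set R, measurable A ->
    F A = (\int[lebesgue_measure]_(x in A) (f x)%:E)%E.
Proof.
move=> hF A mA.
pose rays := [set B : set (measurableTypeR R) | exists t : R, B = `]-oo, t]%classic].
apply: (@measure_unique _ _ _ rays (fun n => `]-oo, n%:R]%classic) _ _ _ _ F density_measure) => //.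
- rewrite eqEsubset; split => B.
    apply: smallest_sub; first exact: smallest_sigma_algebra.
    move=> _ [[c d] _ <-] /=.
    have -> : `]c, d]%classic = `]-oo, d] `\` `]-oo, c].
      by rewrite -[RHS]setCK setCD setCitvl setUC -[LHS]setCK setCitv.
    have rm t : measurable (`]-oo, t]%classic : set (g_sigma_algebraType rays)).
      by apply: sub_sigma_algebra; exists t.
    exact: (measurableD (rm d) (rm c)).
  apply: smallest_sub; first exact: sigma_algebra_measurable.
  by move=> _ [t ->]; exact: measurable_itv.
- move=> _ _ [s ->] [t ->]; exists (Num.min s t).
  by apply/seteqP; split => x /=; rewrite !in_itv /= le_min => /andP.
- by move=> n; exists n%:R.
- apply/seteqP; split => // x _; exists (Num.trunc `|x|).+1 => //=.
  rewrite in_itv /= (le_trans (ler_norm x))// ltW//.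
  by have /andP[] := truncn_itv (normr_ge0 x).
- by move=> _ [t ->]; exact: hF.
- move=> n; apply: le_lt_trans (ltry 1); apply: probability_le1.
  exact: measurable_itv.
Qed.

End DensityMeasure.

(** * From a distribution function to its density *)

Section SmoothDistribution.
Context {R : realType}.
Implicit Types (F : probability (measurableTypeR R) R).

(** Where the difference quotient diverges, [lim] takes its default value 0, so the sign holds at
    every point. *)
Lemma derive1_ge0 (f : R -> R) t : {homo f : x y / x <= y} -> 0 <= derive1 f t.
Proof.
move=> hf; rewrite /derive1; set D := (X in lim X).
have [cD|/dvgP ->//] := pselect (cvg D).
apply: limr_ge => //; near=> h.
have : h != 0 by near: h; exact: nbhs_dnbhs_neq.
rewrite neq_lt => /orP[h0|h0].
  apply: mulr_le0; first by rewrite invr_le0 ltW.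
  by rewrite subr_le0; apply: hf; rewrite gerDr ltW.
apply: mulr_ge0; first by rewrite invr_ge0 ltW.
by rewrite subr_ge0; apply: hf; rewrite lerDr ltW.
Unshelve. all: by end_near. Qed.

Lemma distribution_function_homo F : {homo distribution_function F : x y / x <= y}.
Proof.
move=> x y xy; rewrite /distribution_function fine_le ?fin_num_measure//.
apply: le_measure; rewrite ?inE; [exact: measurable_itv|exact: measurable_itv|].
by apply: subset_itvl.
Qed.

Lemma dens_ge0 F t : 0 <= dens F t.
Proof. exact/derive1_ge0/distribution_function_homo. Qed.

Variables (F : probability (measurableTypeR R) R) (a b : R).
Hypotheses (ab : a < b) (cF : continuous (distribution_function F))
  (Fa : forall t, t <= a -> distribution_function F t = 0)
  (Fb : forall t, b <= t -> distribution_function F t = 1)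
  (dF : {in `]a, b[, forall t, derivable (distribution_function F) t 1})
  (cf : {in `]a, b[, continuous (dens F)}).

Lemma dens_outside t : t \notin `[a, b] -> dens F t = 0.
Proof.
rewrite in_itv /= negb_and -!ltNge => /orP[ta|bt]; rewrite /dens derive1E.
- have h : is_derive t 1 (distribution_function F) 0.
    apply: near_eq_is_derive (is_derive1_cst 0 t).
    near=> s; rewrite Fa// ltW//; near: s; exact: lt_nbhsl.
  by rewrite derive_val.
- have h : is_derive t 1 (distribution_function F) 0.
    apply: near_eq_is_derive (is_derive1_cst 1 t).
    near=> s; rewrite Fb// ltW//; near: s; exact: lt_nbhsr.
  by rewrite derive_val.
Unshelve. all: by end_near. Qed.

(** The derivative is continuous inside and zero outside; a and b, where its value is unknown, are
    split off as measurable points. *)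
Lemma measurable_dens : measurable_fun setT (dens F).
Proof.
have mi : measurable_fun (`]a, b[ : set R) (dens F).
  apply: open_continuous_measurable_fun; first exact: interval_open.
  by move=> t /set_mem; exact: cf.
have m0 : measurable_fun (~` `[a, b]%classic) (dens F).
  have h : {in ~` `[a, b]%classic, (cst 0 : R -> R) =1 dens F}.
    by move=> t; rewrite inE /= => /negP h; rewrite dens_outside.
  by apply: (@eq_measurable_fun _ _ R R _ (cst (0 : R)) (dens F) h).
have -> : [set: R] = `]a, b[ `|` ([set a] `|` ([set b] `|` ~` `[a, b])).
  apply/seteqP; split => // t _ /=; rewrite !in_itv /=.
  have [ta|ta|->] := ltgtP a t; [|by right; right; right|by right; left].
  have [tb|tb|->] := ltgtP t b; [by left| |by right; right; left].
  by right; right; right; rewrite andbF.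
have m2 : measurable (~` `[a, b] : set R) by apply: measurableC.
apply/measurable_funU => //; first by do 2?apply: measurableU.
split=> //; apply/measurable_funU => //; first exact: measurableU.
split; first exact: measurable_fun_set1.
apply/measurable_funU => //; split => //; exact: measurable_fun_set1.
Qed.

(** The density may be unbounded near the ends, so the fundamental theorem is applied on compact
    subintervals, followed by monotone convergence and continuity of the distribution function. *)
Lemma integral_dens_itv t : a < t -> t <= b ->
  (\int[lebesgue_measure]_(x in `]a, t[) (dens F x)%:E =
   (distribution_function F t)%:E)%E.
Proof.
(* A denominator of at least 3 keeps 2 e(n) < t - a, so that no [S n] degenerates. *)
move=> at_ tb; pose e n : R := (t - a) / n.+3%:R.
pose S n : set R := `[a + e n, t - e n]%classic.
have ta : 0 < t - a by rewrite subr_gt0.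
have e0 n : 0 < e n by rewrite divr_gt0.
have e_lt n : a + e n < t - e n.
  have : e n + e n < t - a.
    rewrite /e -mulrDl ltr_pdivrMr//.
    have : (t - a) * 2 < (t - a) * n.+3%:R by rewrite ltr_pM2l// ltr_nat.
    by lra.
  lra.
have ce : e n @[n --> \oo] --> 0.
  rewrite -[X in _ --> X](mulr0 (t - a)); apply: cvgM; first exact: cvg_cst.
  have := @cvg_harmonic R; rewrite -(cvg_shiftn 2) /harmonic /=.
  by under eq_fun do rewrite addn2.
have SE : \bigcup_n S n = `]a, t[%classic.
  apply/seteqP; split => [x [n _]|x]; rewrite /S /= !in_itv /=.
    by move=> /andP[h1 h2]; have := e0 n; lra.
  move=> /andP[ax xt].
  have m0 : 0 < Num.min (x - a) (t - x) by rewrite lt_min !subr_gt0 ax.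
  have [n _ /(_ n (leqnn n)) /=] := cvgr_lt 0 ce _ m0.
  by rewrite lt_min => /andP[h1 h2]; exists n => //=; rewrite in_itv /=; lra.
have Sab n : {subset `[a + e n, t - e n] <= `]a, b[}.
  by move=> x; rewrite !in_itv /= => /andP[h1 h2]; have := e0 n; lra.
have c1 : (\int[lebesgue_measure]_(x in S n) (dens F x)%:E)%E @[n --> \oo] -->
    (\int[lebesgue_measure]_(x in `]a, t[) (dens F x)%:E)%E.
  rewrite -SE; apply: ge0_nondecreasing_set_cvg_integral.
  - move=> n m nm; apply/subsetPset => x; rewrite /S /= !in_itv /=.
    have : e m <= e n.
      by rewrite /e ler_pM2l// lef_pV2 ?posrE// ler_nat.
    by move=> h /andP[h1 h2]; lra.
  - by move=> n; exact: measurable_itv.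
  - move=> n; apply/measurable_EFinP; apply: measurable_funTS.
    exact: measurable_dens.
  - by move=> n x _; rewrite lee_fin dens_ge0.
have c2 : (\int[lebesgue_measure]_(x in S n) (dens F x)%:E)%E @[n --> \oo] -->
    (distribution_function F t)%:E.
  have -> : (fun n => (\int[lebesgue_measure]_(x in S n) (dens F x)%:E)%E) =
    (fun n => (distribution_function F (t - e n) - distribution_function F (a + e n))%:E).
    apply/funext => n; apply: is_derive1_FTC => //.
    - by move=> x /Sab; exact: cf.
    - move=> x /Sab /dF h; rewrite /dens derive1E; exact: DeriveDef.
  apply: cvg_EFin; first by near=> n.
  have ct : t - e n @[n --> \oo] --> t - 0 by apply: cvgB => //; exact: cvg_cst.
  have ca : a + e n @[n --> \oo] --> a + 0 by apply: cvgD => //; exact: cvg_cst.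
  rewrite subr0 in ct; rewrite addr0 in ca.
  rewrite -[X in _ --> X]subr0 -(Fa (lexx a)).
  apply: cvgB.
    by apply: (@cvg_comp _ _ _ _ (distribution_function F) _ _ _ ct); exact: cF.
  by apply: (@cvg_comp _ _ _ _ (distribution_function F) _ _ _ ca); exact: cF.
exact: cvg_unique c1 c2.
Unshelve. all: by end_near. Qed.

Lemma is_density_dens : is_density F (dens F).
Proof.
have mf := measurable_dens; have f0 := dens_ge0 F.
split => //; apply: density_of_cdf => // t.
have -> : (F `]-oo, t]%classic = (distribution_function F t)%:E)%E.
  by rewrite /distribution_function fineK// fin_num_measure.
have mE (D : set R) : measurable_fun D (EFin \o dens F).
  by apply/measurable_EFinP/measurable_funTS.
have i0 (D : set R) : measurable D -> (forall x, D x -> x < a \/ b < x) ->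
    (\int[lebesgue_measure]_(x in D) (dens F x)%:E = 0)%E.
  move=> mD hD; apply: integral0_eq => x /hD h; rewrite dens_outside//.
  by rewrite in_itv /= negb_and -!ltNge; apply/orP.
have itv_setU (c s d : itv_bound R) : (c <= s <= d)%O ->
    (\int[lebesgue_measure]_(x in [set` Interval c d]) (dens F x)%:E =
     \int[lebesgue_measure]_(x in [set` Interval c s]) (dens F x)%:E +
     \int[lebesgue_measure]_(x in [set` Interval s d]) (dens F x)%:E)%E.
  move=> h; rewrite -ge0_integral_setU//=.
  - by case/andP: h => h1 h2; rewrite -itv_bndbnd_setU.
  - exact: mE.
  - by move=> x _; rewrite lee_fin.
  - rewrite disj_set2E; apply/eqP/seteqP; split => // x [] /=.
    rewrite !itv_boundlr => /andP[_ h1] /andP[h2 _].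
    by move: (le_trans h1 h2); rewrite bnd_simp ltxx.
have left0 : (\int[lebesgue_measure]_(x in `]-oo, a]) (dens F x)%:E = 0)%E.
  rewrite -integral_itv_bndo_bndc; last exact: mE.
  by apply: i0 => // x /=; rewrite in_itv /=; left.
have [ta|at_] := leP t a.
  rewrite Fa//; apply/esym/eqP; rewrite eq_le integral_ge0 ?andbT; last first.
    by move=> x _; rewrite lee_fin.
  apply: (@le_trans _ _ (\int[lebesgue_measure]_(x in `]-oo, a]) (dens F x)%:E)%E).
    2: by rewrite left0.
  apply: ge0_subset_integral => //.
  - exact: mE.
  - by move=> x _; rewrite lee_fin.
  - exact: subset_itvl.
rewrite [RHS](itv_setU _ (BRight a)) ?left0 ?add0e; last by rewrite !bnd_simp ltW.
have int_oc s : a < s -> s <= b ->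
    (\int[lebesgue_measure]_(x in `]a, s]) (dens F x)%:E =
     (distribution_function F s)%:E)%E.
  by move=> *; rewrite -integral_itv_bndo_bndc ?integral_dens_itv.
have [tb|bt] := leP t b; first by rewrite int_oc.
rewrite [RHS](itv_setU _ (BRight b)); last by rewrite !bnd_simp !ltW.
rewrite int_oc// i0 ?adde0//; last first.
  by move=> x /=; rewrite in_itv /= => /andP[? _]; right.
by rewrite !Fb// ltW.
Qed.

End SmoothDistribution.

Lemma at_right_itvoo {R : realType} (a b : R) : a < b ->
  \forall t \near a^'+, t \in `]a, b[.
Proof.
move=> ab; apply: filterS (filterI (nbhs_right_gt a) (nbhs_right_lt ab)) => t.
by rewrite in_itv /= => -[-> ->].
Qed.

Lemma at_left_itvoo {R : realType} (a b : R) : a < b ->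
  \forall t \near b^'-, t \in `]a, b[.
Proof.
move=> ab; apply: filterS (filterI (nbhs_left_gt ab) (nbhs_left_lt b)) => t.
by rewrite in_itv /= => -[-> ->].
Qed.

(** The endpoints are limits of interior points, so S may or may not contain them, as suits a
    derivative that is not controlled at the edges. *)
Lemma closure_itvoo {R : realType} (a b : R) (S : set R) : a < b ->
  `]a, b[ `<=` S -> S `<=` `[a, b] -> closure S = `[a, b]%classic.
Proof.
move=> ab h1 h2; apply/seteqP; split.
  rewrite closureE => x; apply; split => //; exact: itv_closed.
move=> x xab B Bx; have [xa|xa] := eqVneq x a.
  have na : \forall s \near a^'+, s \in `]a, b[ by exact: at_right_itvoo.
  rewrite xa in Bx; have Ba : \forall s \near a^'+, B s by exact: cvg_at_right_filter Bx.
  have [s [s1 s2]] := filter_ex (filterI na Ba).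
  by exists s; split => //; exact: h1.
have [xb|xb] := eqVneq x b.
  have nb : \forall s \near b^'-, s \in `]a, b[ by exact: at_left_itvoo.
  rewrite xb in Bx; have Bb : \forall s \near b^'-, B s by exact: cvg_at_left_filter Bx.
  have [s [s1 s2]] := filter_ex (filterI nb Bb).
  by exists s; split => //; exact: h1.
exists x; split; last exact: nbhs_singleton.
apply: h1; move: xab; rewrite /= !in_itv /= => /andP[h3 h4].
by rewrite !lt_neqAle h3 h4 eq_sym xa xb.
Qed.

(** * Density, support and edge behaviour *)

Section FussDensity.
Context {R : realType} (r : nat) (r0 : (0 < r)%N).
Local Notation fa := (@fuss_angle R r).
Local Notation Lr := (L R r).
Variable F : probability (measurableTypeR R) R.
Hypothesis hF : has_moments F (fun k : nat => ('C(r.+1 * k, k))%:R / k.+1%:R).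

Let pi0 : 0 < pi :> R. Proof. exact: pi_gt0. Qed.
Let rR : 0 < r%:R :> R. Proof. by rewrite ltr0n. Qed.

Lemma is_derive_fuss_cdf t : t \in `]0, Lr[ ->
  is_derive t 1 (@fuss_cdf R r) (fuss_dens r (fuss_inv r t)).
Proof.
move=> tL; have pa := fuss_inv_itvoo r0 tL.
have v0 := sin_ratio_gt0_angle r0 (subset_itv_oo_cc pa).
have v1 := sin_ratioS_gt0_angle (subset_itv_oo_co pa).
have d0 := fuss_dx_lt0 r0 pa.
have h : is_derive t 1 (fun s => 1 - fuss_tail r (fuss_inv r s)) (fuss_dens r (fuss_inv r t)).
  apply: is_derive_cast (is_derive1B (is_derive1_cst 1 t)
    (is_derive1_chain (is_derive_fuss_tail r0 _) (is_derive_fuss_inv r0 tL))) _.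
  have e := fuss_dx_fuss_dens r0 (lt0r_neq0 v0) (lt0r_neq0 v1).
  have {e} -> : fuss_weight r (fuss_inv r t) = - (fuss_dx r (fuss_inv r t) * fuss_dens r (fuss_inv r t)).
    by rewrite e opprK.
  by field; rewrite lt_eqF.
apply: near_eq_is_derive h; near=> s; rewrite /fuss_cdf clamp_id//.
by apply: subset_itv_oo_cc; near: s; exact: near_in_itvoo.
Unshelve. all: by end_near. Qed.

Lemma densE t : t \in `]0, Lr[ -> dens F t = fuss_dens r (fuss_inv r t).
Proof.
move=> tL; rewrite /dens (distribution_functionE r0 hF) derive1E.
by have h := is_derive_fuss_cdf tL; rewrite derive_val.
Qed.

Lemma fuss_dens_gt0 p : p \in `]0, fa[ -> 0 < fuss_dens r p.
Proof.
move=> pa; rewrite divr_gt0 ?mulr_gt0 ?exprn_gt0//.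
- exact: sin_fuss_angle_gt0 (subset_itv_oo_oc pa).
- exact: sin_ratio_gt0_angle (subset_itv_oo_cc pa).
- exact: sin_ratioS_gt0_angle (subset_itv_oo_co pa).
Qed.

Lemma continuous_fuss_dens p : p \in `]0, fa[ -> {for p, continuous (@fuss_dens R r)}.
Proof.
move=> pa.
have v1 := sin_ratioS_gt0_angle (subset_itv_oo_co pa).
have h := is_derive1M (is_derive1M (is_derive_sin p)
  (is_derive1X r.+1 (is_derive_sin_ratio r p))) (@is_derive1V _ (fun p => r%:R * pi * sin_ratio r.+1 p ^+ r) _ _ _
  (is_derive1M (is_derive1_cst (r%:R * pi) p) (is_derive1X r (is_derive_sin_ratio r.+1 p)))).
apply: is_derive1_continuous (h _).
by rewrite !mulf_neq0 ?expf_neq0// gt_eqF.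
Qed.

Lemma is_density_fuss : is_density F (dens F).
Proof.
have FE := distribution_functionE r0 hF.
apply: (@is_density_dens _ F 0 Lr); rewrite ?FE.
- exact: L_gt0.
- exact: continuous_fuss_cdf.
- exact: fuss_cdf_le0.
- exact: fuss_cdf_geL.
- by move=> t /is_derive_fuss_cdf; case.
- move=> t tL.
  have h : {for t, continuous (fun s => fuss_dens r (fuss_inv r (clamp r s)))}.
    apply: (@cvg_comp _ _ _ (fun s => fuss_inv r (clamp r s)) (@fuss_dens R r) _
      (nbhs (fuss_inv r (clamp r t)))).
      exact: continuous_fuss_inv_clamp.
    rewrite clamp_id; last exact: subset_itv_oo_cc.
    exact: continuous_fuss_dens (fuss_inv_itvoo r0 tL).
  have e : dens F t = fuss_dens r (fuss_inv r (clamp r t)).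
    by rewrite densE// clamp_id//; exact: subset_itv_oo_cc.
  rewrite /continuous_at e.
  apply: cvg_trans h; apply: near_eq_cvg; near=> s.
  have sL : s \in `]0, Lr[ by near: s; exact: near_in_itvoo.
  by rewrite densE// clamp_id//; exact: subset_itv_oo_cc.
Unshelve. all: by end_near. Qed.

Lemma support_fuss : closure [set x : R | 0 < dens F x] = `[0, Lr]%classic.
Proof.
apply: closure_itvoo; first exact: L_gt0.
  by move=> t tL /=; rewrite densE// fuss_dens_gt0// fuss_inv_itvoo.
move=> t /=; apply: contraTT => tL.
have FE := distribution_functionE r0 hF.
rewrite (@dens_outside _ F 0 Lr) ?ltxx//; rewrite FE.
- exact: fuss_cdf_le0.
- exact: fuss_cdf_geL.
Qed.

Let q : R := r%:R / r.+1%:R.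
(** This is f x^q after the factor vanishing at pi/(r+1) has cancelled; the remaining real power is
    written with [expR] and [ln] so that the derivative rules give continuity. *)
Let h p : R := sin p * sin_ratio r p ^+ r.+1 / (r%:R * pi) * expR (q * ln (sin_ratio r p ^- r)).

Let continuous_h : {for fa, continuous h}.
Proof.
have v0 : 0 < sin_ratio r fa by apply: sin_ratio_gt0_angle => //; rewrite in_itv /= lexx ltW// fuss_angle_gt0.
have vr0 : sin_ratio r fa ^+ r != 0 by rewrite expf_neq0// gt_eqF.
have vr1 : 0 < sin_ratio r fa ^- r by rewrite invr_gt0 exprn_gt0.
have hV := @is_derive1V _ (fun p => sin_ratio r p ^+ r) _ _ vr0 (is_derive1X r (is_derive_sin_ratio r fa)).
have hl := @is_derive1_chain _ (@ln R) (fun p => sin_ratio r p ^- r) _ _ _ (is_derive1_ln vr1) hV.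
have he := @is_derive1_chain _ expR (fun p => q * ln (sin_ratio r p ^- r)) _ _ _ (is_derive_expR _) (is_derive1M (is_derive1_cst q fa) hl).
have hs := is_derive1M (is_derive1M (is_derive_sin fa)
  (is_derive1X r.+1 (is_derive_sin_ratio r fa))) (is_derive1_cst (r%:R * pi)^-1 fa).
exact: is_derive1_continuous (is_derive1M hs he).
Qed.

Let h_gt0 : 0 < h fa.
Proof.
have ina : fa \in `[0, fa] by rewrite in_itv /= lexx ltW// fuss_angle_gt0.
have ina' : fa \in `]0, fa] by rewrite in_itv /= fuss_angle_gt0 lexx.
apply: mulr_gt0; last exact: expR_gt0.
apply: divr_gt0; last exact: mulr_gt0.
apply: mulr_gt0; first exact: sin_fuss_angle_gt0 ina'.
by rewrite exprn_gt0// (sin_ratio_gt0_angle r0 ina).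
Qed.

Let fuss_dens_powR p : p \in `]0, fa[ -> fuss_dens r p * fuss_x r p `^ q = h p.
Proof.
move=> pa; have v0 := sin_ratio_gt0_angle r0 (subset_itv_oo_cc pa).
have v1 := sin_ratioS_gt0_angle (subset_itv_oo_co pa).
have vr1 : 0 < sin_ratio r p ^- r by rewrite invr_gt0 exprn_gt0.
rewrite /fuss_x powRM ?exprn_ge0 ?(ltW vr1) ?(ltW v1)//.
rewrite -powR_mulrn ?(ltW v1)// -powRrM.
(* This fixes the exponent: x^q supplies exactly the factor [sin_ratio r.+1 p ^+ r] found in the
   denominator of f. *)
have -> : r.+1%:R * q = r%:R by rewrite /q mulrC divfK// pnatr_eq0.
rewrite powR_mulrn ?(ltW v1)// [X in _ * (_ * X)]/powR (gt_eqF vr1) /fuss_dens /h.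
have v1n : sin_ratio r.+1 p ^+ r != 0 by rewrite expf_neq0// gt_eqF.
have pn0 : (pi : R) != 0 by rewrite gt_eqF.
have rn0 : (r%:R : R) != 0 by rewrite gt_eqF.
by move: (pi : R) pn0 => y y0; field; rewrite y0 v1n rn0.
Qed.

Lemma fuss_at0 : exists2 c : R, 0 < c &
  dens F x / (c * x `^ (- (r%:R / r.+1%:R))) @[x --> 0^'+] --> (1 : R).
Proof.
exists (h fa) => //.
have c1 : h (fuss_inv r (clamp r t)) / h fa @[t --> 0^'+] --> (1 : R).
  rewrite -[X in _ --> X](@divff _ (h fa)) ?gt_eqF//; apply: cvgM; last exact: cvg_cst.
  apply: cvg_at_right_filter.
  apply: (@cvg_comp _ _ _ (fun s => fuss_inv r (clamp r s)) h _ (nbhs fa)); last exact: continuous_h.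
  have := @continuous_fuss_inv_clamp R r r0 0.
  by rewrite /continuous_at clamp_le0// fuss_inv0.
apply: cvg_trans c1; apply: near_eq_cvg; near=> t.
have tL : t \in `]0, Lr[ by near: t; apply: at_right_itvoo; exact: L_gt0.
have tL' := subset_itv_oo_cc tL.
rewrite clamp_id// -fuss_dens_powR; last exact: fuss_inv_itvoo.
have swap (x y z : R) : x * y / z = x / (z * y^-1).
  by rewrite invfM invrK mulrA mulrAC.
by rewrite fuss_xK// densE// powRN swap.
Unshelve. all: by end_near. Qed.

(** x as a function of c = cos p. *)
Let Rc (c : R) := (chebU R r.+1).[c] ^+ r.+1 / (chebU R r).[c] ^+ r.

Let Rc_derive : exists2 l : R, 0 < l & is_derive (1 : R) 1 Rc l.
Proof.
have u0 : (chebU R r).[1] != 0 by rewrite chebU1 gt_eqF.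
eexists; last exact: (is_derive1_powratio r u0 (is_derive_poly _ _) (is_derive_poly _ _)).
rewrite !chebU1; apply: divr_gt0; last by rewrite exprn_gt0.
apply: mulr_gt0; first by rewrite exprn_gt0// ltr0n.
have := @deriv_chebU1 R r; have := @deriv_chebU1 R r.+1.
move: (deriv (chebU R r.+1)).[1] (deriv (chebU R r)).[1] => A B hA hB.
have -> : r.+1%:R * A * r%:R - r%:R * r.+1%:R * B = r%:R * r.+1%:R * (A - B) by ring.
rewrite !mulr_gt0 ?ltr0n//.
(* The cubes in [deriv_chebU1] telescope to A - B = r (r + 1), which is positive. *)
have e : 3 * (A - B) = 3 * (r%:R * (r%:R + 1)).
  by rewrite mulrBr hA hB -natr1; ring.
by rewrite -(pmulr_rgt0 _ (ltr0Sn R 2)) e !mulr_gt0// addr_gt0.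
Qed.

(** Carathéodory's form of the derivative of [Rc] gives L(r) - x = (1 - cos p) g(cos p) = sin^2 p
    K(p), while f = sin p Q(p); the factor sin p cancels against the square root. *)
Lemma fuss_atL : exists2 c' : R, 0 < c' &
  dens F x / (c' * Num.sqrt (Lr - x)) @[x --> Lr^'-] --> (1 : R).
Proof.
have [l l0 /is_derive1_caratheodory [g [gE gC g1]]] := Rc_derive.
pose K (p : R) := g (cos p) / (1 + cos p).
pose Q (p : R) := sin_ratio r p ^+ r.+1 / (r%:R * pi * sin_ratio r.+1 p ^+ r).
have K0 : 0 < K 0 by rewrite /K cos0 g1 divr_gt0.
have Q0 : 0 < Q 0.
  by rewrite /Q !sin_ratio0 divr_gt0 ?exprn_gt0// mulr_gt0 ?mulr_gt0// exprn_gt0 // ltr0n.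
have cK : {for 0, continuous K}.
  apply: cvgM.
    apply: (@cvg_comp _ _ _ cos g _ _ _ (@continuous_cos R 0)).
    by rewrite cos0; exact: gC.
  apply: cvgV; first by rewrite cos0 gt_eqF.
  by apply: cvgD; [exact: cvg_cst|exact: continuous_cos].
have cQ : {for 0, continuous Q}.
  have v1 : r%:R * pi * sin_ratio r.+1 (0 : R) ^+ r != 0.
    by rewrite sin_ratio0 !mulf_neq0 ?expf_neq0 ?pnatr_eq0// gt_eqF.
  exact: is_derive1_continuous (is_derive1M (is_derive1X r.+1 (is_derive_sin_ratio r 0))
   (@is_derive1V _ (fun p => r%:R * pi * sin_ratio r.+1 p ^+ r) _ _ v1
  (is_derive1M (is_derive1_cst (r%:R * pi) 0) (is_derive1X r (is_derive_sin_ratio r.+1 0))))).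
have sK0 : 0 < Num.sqrt (K 0) by rewrite sqrtr_gt0.
(* The limit at p = 0 of f / sqrt (L(r) - x) = Q(p) / sqrt (K(p)). *)
exists (Q 0 / Num.sqrt (K 0)); first by rewrite divr_gt0.
pose H (p : R) := Q p / (Q 0 / Num.sqrt (K 0) * Num.sqrt (K p)).
have cH : {for 0, continuous H}.
  apply: cvgM; first exact: cQ.
  apply: cvgV; first by rewrite mulf_neq0// gt_eqF// divr_gt0.
  apply: cvgM; first exact: cvg_cst.
  by apply: (@cvg_comp _ _ _ K Num.sqrt _ _ _ cK); exact: sqrt_continuous.
have H0 : H 0 = 1.
  by rewrite /H divfK ?gt_eqF// divff// gt_eqF.
have c1 : H (fuss_inv r (clamp r t)) @[t --> Lr^'-] --> (1 : R).
  rewrite -H0; apply: cvg_at_left_filter.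
  apply: (@cvg_comp _ _ _ (fun s => fuss_inv r (clamp r s)) H _ (nbhs (0 : R))); last exact: cH.
  have := @continuous_fuss_inv_clamp R r r0 Lr.
  by rewrite /continuous_at clamp_geL// fuss_invL.
apply: cvg_trans c1; apply: near_eq_cvg; near=> t.
have tL : t \in `]0, Lr[ by near: t; apply: at_left_itvoo; exact: L_gt0.
have tL' := subset_itv_oo_cc tL.
rewrite clamp_id// densE//.
have pa := fuss_inv_itvoo r0 tL.
rewrite -[X in Lr - X](fuss_xK r0 tL').
move: (fuss_inv r t) pa => p pa.
have sp := sin_fuss_angle_gt0 r0 (subset_itv_oo_oc pa).
have cp : cos p < 1.
  have := cos2Dsin2 p; have : 0 < sin p ^+ 2 by rewrite exprn_gt0.
  by have := cos_le1 p; rewrite le_eqVlt => /predU1P[->|//]; rewrite expr1n; lra.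
have cp' : 0 < 1 + cos p.
  have := cos2Dsin2 p; have : 0 < sin p ^+ 2 by rewrite exprn_gt0.
  by have := cos_geN1 p; rewrite le_eqVlt => /predU1P[<-|]; rewrite ?sqrrN ?expr1n; lra.
have -> : Lr - fuss_x r p = sin p ^+ 2 * K p.
  rewrite -(fuss_x0 r) /K.
  have -> : fuss_x r 0 - fuss_x r p = - (Rc (cos p) - Rc 1) by rewrite /fuss_x /sin_ratio cos0 opprB.
  rewrite gE sin2cos2; field; by rewrite gt_eqF.
have -> : Num.sqrt (sin p ^+ 2 * K p) = sin p * Num.sqrt (K p).
  by rewrite [LHS]sqrtrM ?sqr_ge0// sqrtr_sqr gtr0_norm.
rewrite /H /fuss_dens.
have -> : sin p * sin_ratio r p ^+ r.+1 / (r%:R * pi * sin_ratio r.+1 p ^+ r) = sin p * Q p.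
  by rewrite /Q mulrA.
have simpl_sin (x y z w : R) : x != 0 -> x * y / (z * (x * w)) = y / (z * w).
  by move=> x0; rewrite mulrCA -mulf_div divff// mul1r.
by rewrite [in RHS]simpl_sin// gt_eqF.
Unshelve. all: by end_near. Qed.

End FussDensity.

Unset Implicit Arguments.

Theorem corollary1 (R : realType) (r : nat) (hr : (1 <= r)%N)
    (F : probability (measurableTypeR R) R)
    (hF : has_moments F (fun k : nat => ('C(r.+1 * k, k))%:R / k.+1%:R)) :
  [/\ is_density F (dens F),
      closure [set x : R | 0 < dens F x] = `[0, L R r]%classic,
      exists2 c : R, 0 < c &
        dens F x / (c * x `^ (- (r%:R / r.+1%:R))) @[x --> 0^'+] --> (1 : R)
    & exists2 c' : R, 0 < c' &
        dens F x / (c' * Num.sqrt (L R r - x)) @[x --> (L R r)^'-] --> (1 : R)].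
Proof.
split.
- exact: (is_density_fuss hr hF).
- exact: (support_fuss hr hF).
- exact: (fuss_at0 hr hF).
- exact: (fuss_atL hr hF).
Qed.
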